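(* Let $G$ and $H$ be countable discrete groups with $G$ infinite, and let $X$ and $Y$ be compact metrizable spaces. Let $G\curvearrowright X$ and $H\curvearrowright Y$ be minimal actions, and suppose that the first action has the uniform Rokhlin property (URP) and comparison. Then the product action $G\times H\curvearrowright X\times Y$ given by $(g,h)(x,y)=(gx,hy)$ is squarely divisible.
   Context: Actions are by homeomorphisms. An action is minimal if the only closed invariant subsets are the empty set and the whole space. The following definitions are for an action $G\curvearrowright X$ of a countable discrete group on a compact metrizable space (applied also to $G\times H\curvearrowright X\times Y$). $M_G(X)$ is the set of $G$-invariant Borel probability measures on $X$. $A^c$ denotes complement. For $V\subseteq X$ and $E\subseteq G$, $V^E=\bigcap_{s\in E}s^{-1}V$ and $EV=\bigcup_{s\in E}sV$. For $E\subseteq G$ finite and $\delta>0$, a finite set $F\subseteq G$ is $(E,\delta)$-invariant if $|\bigcap_{s\in E\cup\{e\}}s^{-1}F|\ge(1-\delta)|F|$. A tower is a pair $(S,B)$ with $S\subseteq G$ nonempty finite (the shape) and $B\subseteq X$ nonempty such that the sets $sB$, $s\in S$ (the levels) are pairwise disjoint. A castle is a finite collection $\{(S_k,V_k)\}_{k\in K}$ of towers with the sets $S_kV_k$ pairwise disjoint; its remainder is $X\setminus\bigsqcup_kS_kV_k$; it is open if all levels are open. URP: for every finite $E\subseteq G$ and $\delta>0$ there is an open castle with $(E,\delta)$-invariant shapes whose remainder $R$ satisfies $\sup_{\mu\in M_G(X)}\mu(R)<\delta$. Subequivalence: for $A\subseteq X$ closed and $B\subseteq X$ open, $A\prec B$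 means there are open sets $U_1,\dots,U_n\subseteq X$ and $s_1,\dots,s_n\in G$ with $A\subseteq\bigcup_iU_i$ and the sets $s_iU_i$ pairwise disjoint subsets of $B$. Comparison: $A\prec B$ for all closed $A$ and open $B$ with $\mu(A)<\mu(B)$ for every $\mu\in M_G(X)$. Sets $V_1,\dots,V_M\subseteq X$ are pairwise equivalent if there are finitely many Borel sets $\{C_k\}_{k\in K}$ with $V_1=\bigsqcup_kC_k$ and elements $s_{k,m}\in G$ ($k\in K$, $1\le m\le M$) with $s_{k,1}=e$ such that $V_m=\bigsqcup_ks_{k,m}C_k$ for all $m$ and the sets $s_{k,m}C_k$, over all $k$ and $m$, have pairwise disjoint closures. The members of a collection $\mathscr V$ of subsets of $X$ are pairwise $E$-disjoint if the sets $E\overline V$, $V\in\mathscr V$, are pairwise disjoint. Let $O_1,O_2\subseteq X$ be open and $E\subseteq G$ finite with $e\in E$. The action is $(O_1,O_2,E)$-squarely divisible if there exist $n\in\mathbb N$, a collection $\{V_{i,j}\}_{i,j=1}^n$ of pairwise equivalent and pairwise $E$-disjoint open subsets of $X$ and, writing $V=\bigsqcup_{i,j}V_{i,j}$, an open set $U\supseteq\partial V$ such that, with $V_1=\bigsqcup_{i=1}^nV_{i,1}$, $R=V^c$, and $B=\overline V\cap((V\cap\overline U^c)^E)^c$: (i) $\overline{V_{i,1}}\prec O_1\cap\bigsqcup_{j=2}^nV_{i,j}\cap B^c$ for every $i=1,\dots,n$; (ii) $R\prec O_2\cap V\cap(V_1\cup B)^c$; (iii) $B\cup(\overline U\cap R)\prec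 O_2\cap\overline{V\cup U}^c$. For a nonempty open $O\subseteq X$, the action is $O$-squarely divisible if there are nonempty open sets $O_0\subseteq O$ and $O_1,O_2\subseteq X$, the three having pairwise disjoint closures, such that $\overline{O_1}\sqcup\overline{O_2}\prec O_0$ and the action is $(O_1,O_2,E)$-squarely divisible for all finite $E\subseteq G$ containing $e$. The action is squarely divisible if it is $O$-squarely divisible for every nonempty open $O\subseteq X$. *)

(* Defs.v *)
From HB Require Import structures.
From mathcomp Require Import all_boot all_order all_algebra finmap.
From mathcomp Require Import all_classical all_reals all_analysis.

Set Implicit Arguments.
Unset Strict Implicit.
Unset Printing Implicit Defensive.

Import Order.TTheory GRing.Theory Num.Theory.

Local Open Scope classical_set_scope.
Local Open Scope ring_scope.

Definition borel_set (X : topologicalType) : set (set X) := <<s @open X >>.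

(* A [measurableType] has a distinguished point, whereas a space here may be
   empty, so its Borel structure is built relative to a point [p]. Neither the
   measurable sets nor the notion of measure depends on [p], and an empty space
   carries no probability measure. *)
Definition pointed_at (T : choiceType) (p : T) : Type := T.
HB.instance Definition _ (T : choiceType) (p : T) :=
  Choice.on (pointed_at p).
HB.instance Definition _ (T : choiceType) (p : T) :=
  isPointed.Build (pointed_at p) p.

Notation borelType p :=
  (g_sigma_algebraType (open : set (set (pointed_at p)))).

(* Each [act g] is a homeomorphism, its inverse being [act g^-1]. *)
Record topAction (G : groupType) (X : topologicalType) := TopAction {
  act :> G -> X -> X;
  act_one : forall x, act 1%g x = x;
  act_mul : forall g h x, act (g * h)%g x = act g (act h x);
  act_continuous : forall g, continuous (act g) }.

Section ProductAction.
Variables (G H : groupType) (X Y : topologicalType).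
Variables (a : topAction G X) (b : topAction H Y).

Definition prod_act (gh : G * H) (xy : X * Y) : X * Y :=
  (a gh.1 xy.1, b gh.2 xy.2).

Lemma prod_act_one xy : prod_act 1%g xy = xy.
Proof. by case: xy => x y; rewrite /prod_act /= !act_one. Qed.

Lemma prod_act_mul gh gh' xy :
  prod_act (gh * gh')%g xy = prod_act gh (prod_act gh' xy).
Proof. by rewrite /prod_act /= !act_mul. Qed.

Lemma prod_act_continuous gh : continuous (prod_act gh).
Proof.
move=> [x y]; apply: cvg_pair => /=.
- by apply: (cvg_comp _ _ cvg_fst); exact: act_continuous.
- by apply: (cvg_comp _ _ cvg_snd); exact: act_continuous.
Qed.

Definition prod_action : topAction (G * H)%type (X * Y)%type :=
  TopAction prod_act_one prod_act_mul prod_act_continuous.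

End ProductAction.

Section Actions.
Variables (G : groupType) (X : topologicalType) (a : topAction G X).
Implicit Types (A B C O U V : set X) (E F S : {fset G}) (s t : G).

Definition minimal_action :=
  forall C, closed C -> (forall s, a s @` C = C) -> C = set0 \/ C = setT.

(* $V^E = \bigcap_{s \in E} s^{-1}V$ and $EV = \bigcup_{s \in E} sV$. *)
Definition set_core V E : set X := \bigcap_(s in [set` E]) (a s^-1%g @` V).
Definition set_saturate E V : set X := \bigcup_(s in [set` E]) (a s @` V).

Definition invariant_measures (R : realType) : set (set X -> \bar R) :=
  [set mu | (exists (p : X) (P : probability (borelType p) R),
               mu = P :> (set X -> \bar R)) /\
            forall s A, borel_set A -> mu (a s @` A) = mu A].

Definition approx_invariant (R : realType) E (delta : R) F : Prop :=
  (1 - delta) * #|` F|%:R <=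
  #|` fset_set (\bigcap_(s in [set` (1%g |` E)%fset])
                  ((fun t => (s^-1 * t)%g) @` [set` F]))|%:R.

Definition tower S B : Prop :=
  [/\ S != fset0%fset, B !=set0 & trivIset [set` S] (fun s => a s @` B)].

Definition castle (K : finType) (S : K -> {fset G}) (V : K -> set X) : Prop :=
  (forall k, tower (S k) (V k)) /\
  trivIset setT (fun k => set_saturate (S k) (V k)).

Definition castle_open (K : finType) (S : K -> {fset G}) (V : K -> set X) :=
  forall k s, s \in S k -> open (a s @` V k).

Definition castle_remainder (K : finType) (S : K -> {fset G})
    (V : K -> set X) : set X :=
  ~` \bigcup_k set_saturate (S k) (V k).

(* The supremum is taken in the extended reals, so that it is [-oo] when there
   is no invariant probability measure. *)
Definition uniform_Rokhlin_property (R : realType) : Prop :=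
  forall E (delta : R), 0 < delta ->
    exists (K : finType) (S : K -> {fset G}) (V : K -> set X),
      [/\ castle S V,
          castle_open S V,
          forall k, approx_invariant E delta (S k) &
          (ereal_sup [set mu (castle_remainder S V)
                     | mu in @invariant_measures R] < delta%:E)%E].

Definition subequivalent A B : Prop :=
  exists (n : nat) (U : 'I_n -> set X) (s : 'I_n -> G),
    [/\ forall i, open (U i),
        A `<=` \bigcup_i U i,
        trivIset setT (fun i => a (s i) @` U i) &
        forall i, a (s i) @` U i `<=` B].

Definition comparison (R : realType) : Prop :=
  forall A B, closed A -> open B ->
    (forall mu : set X -> \bar R, invariant_measures mu -> (mu A < mu B)%E) ->
    subequivalent A B.

(* [i0] is the index of the set called $V_1$. The unions over [k] are disjoint
   by the last condition. *)
Definition pairwise_equivalent (I : finType) (i0 : I) (V : I -> set X) : Prop :=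
  exists (K : finType) (C : K -> set X) (s : K -> I -> G),
    [/\ forall k, borel_set (C k),
        V i0 = \bigcup_k C k,
        forall k, s k i0 = 1%g,
        forall m, V m = \bigcup_k (a (s k m) @` C k) &
        trivIset setT (fun km : K * I => closure (a (s km.1 km.2) @` C km.1))].

Definition pairwise_disjoint_under (I : finType) E (V : I -> set X) : Prop :=
  trivIset setT (fun i => set_saturate E (closure (V i))).

Definition topological_boundary V : set X := closure V `\` interior V.

(* The indices $1, \dots, n$ are the elements of ['I_n.+1], with [ord0] in the
   role of $1$. *)
Definition squarely_divisible_wrt (O1 O2 : set X) E : Prop :=
  exists (n : nat) (W : 'I_n.+1 -> 'I_n.+1 -> set X) (U : set X),
    let V := \bigcup_i \bigcup_j W i j in
    let V1 := \bigcup_i W i ord0 in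
    let Rm := ~` V in
    let B := closure V `&` ~` set_core (V `&` ~` closure U) E in
    [/\ [/\ forall i j, open (W i j),
            pairwise_equivalent (ord0, ord0) (fun ij => W ij.1 ij.2) &
            pairwise_disjoint_under E
              (fun ij : 'I_n.+1 * 'I_n.+1 => W ij.1 ij.2)],
        open U /\ topological_boundary V `<=` U,
        forall i, subequivalent (closure (W i ord0))
          (O1 `&` \bigcup_(j in [set j | j != ord0]) W i j `&` ~` B),
        subequivalent Rm (O2 `&` V `&` ~` (V1 `|` B)) &
        subequivalent (B `|` (closure U `&` Rm))
          (O2 `&` ~` closure (V `|` U))].

Definition squarely_divisible_in (O : set X) : Prop :=
  exists O0 O1 O2 : set X,
    [/\ [/\ open O0, open O1 & open O2],
        [/\ O0 !=set0, O1 !=set0 & O2 !=set0],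
        O0 `<=` O,
        [/\ closure O0 `&` closure O1 = set0,
            closure O0 `&` closure O2 = set0 &
            closure O1 `&` closure O2 = set0] &
        subequivalent (closure O1 `|` closure O2) O0 /\
        forall E, 1%g \in E -> squarely_divisible_wrt O1 O2 E].

Definition squarely_divisible : Prop :=
  forall O, open O -> O !=set0 -> squarely_divisible_in O.

End Actions.

(* Main.v *)
From HB Require Import structures.
Require Import Defs.
From mathcomp Require Import all_boot all_order all_algebra finmap.
From mathcomp Require Import all_classical all_reals all_analysis.
From mathcomp Require Import lra ring.

(* Only the action on [X] matters for the square: sets of the form [A * Y] turn
   square divisibility of [X] relative to nonempty open [P1], [P2] into that of
   the product relative to [P1 * Y], [P2 * Y]. The second action enters once:
   finitely many translates of an open set cover [Y], so small sets [A * Y]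
   embed into any nonempty open subset of the product.

   On [X], comparison supplies invariant measures and, with minimality and the
   infinite orbits given by a castle, nonempty open sets of arbitrarily small
   mass. A castle with small remainder then visits its remainder rarely along
   every orbit, so pulling back its towers along one orbit tiles every
   sufficiently invariant finite subset of [G]. Distributing the tiles of each
   shape evenly splits the shapes of a second, much more invariant castle into
   [(n+1)^2 + 1] equal bins that are separated under [E]. All but one of the bins
   form the square; the last one is left empty. By minimality each bin spends
   a definite proportion of its mass in [P1] and in [P2], and the three
   subequivalences follow from comparison by counting. *)

Set Implicit Arguments.
Unset Strict Implicit.
Unset Printing Implicit Defensive.

Import Order.TTheory GRing.Theory Num.Theory.

Local Open Scope classical_set_scope.
Local Open Scope ring_scope.

(** * Topology of actions *)

(** Pairwise equivalence matches the levels of all cells bijectively, so the bins must have exactly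
    the same cardinality, and any two of them must stay disjoint under [E]. Invariance of a finite
    subset of [G] does not by itself suggest such a partition. Tiles do: they are disjoint
    translates of finitely many shapes, so equal numbers of tiles of each shape give equal bins. The
    bound on visits to the remainder is combinatorial, hence valid for every orbit and every finite
    set. The constants are q = |E|, where [E] contains the given finite set and the visiting times
    to both open sets, n = 16q, N = (n+1)^2 + 1 and eps = 1/(16Nq). A bin has mass at most 1/N = 16q
    eps. Turning visiting times into mass costs a factor q, so a bin is only guaranteed mass 8 eps
    in a given open set. The n cells of a row off the first column then guarantee 128q eps, more
    than the 16q eps of one cell in (i) and the 18q eps outside the square in (ii). The empty bin
    offers 8 eps against the 2 eps to be absorbed in (iii). *)

Section ActionTopology.
Variables (G : groupType) (X : topologicalType) (a : topAction G X).
Implicit Types (s t : G) (A B : set X) (E F S : {fset G}).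

Lemma actK s : cancel (a s) (a s^-1%g).
Proof. by move=> x; rewrite -act_mul mulVg act_one. Qed.

Lemma actVK s : cancel (a s^-1%g) (a s).
Proof. by move=> x; rewrite -act_mul mulgV act_one. Qed.

Lemma act_inj s : injective (a s).
Proof. exact: can_inj (actK s). Qed.

Lemma act_imageE s A : a s @` A = a s^-1%g @^-1` A.
Proof.
apply/seteqP; split=> [_ [x Ax <-]|x Ax] /=; first by rewrite actK.
by exists (a s^-1%g x) => //; rewrite actVK.
Qed.

Lemma act_image_mem s A x : (a s @` A) (a s x) = A x.
Proof. by rewrite act_imageE /= actK. Qed.

Lemma act_imageM s t A : a s @` (a t @` A) = a (s * t)%g @` A.
Proof.
rewrite !act_imageE; apply/seteqP; split=> x /=;
  by rewrite invgM act_mul.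
Qed.

Lemma act_image1 A : a 1%g @` A = A.
Proof. by rewrite act_imageE invg1; apply/seteqP; split=> x /=; rewrite act_one. Qed.

Lemma open_act_preimage s A : open A -> open (a s @^-1` A).
Proof. by move=> oA; apply: open_comp => // x _; exact: act_continuous. Qed.

Lemma closed_act_preimage s A : closed A -> closed (a s @^-1` A).
Proof. by move=> cA; apply: preimage_closed => // x _; exact: act_continuous. Qed.

Lemma open_act_image s A : open A -> open (a s @` A).
Proof. by rewrite act_imageE; exact: open_act_preimage. Qed.

Lemma closed_act_image s A : closed A -> closed (a s @` A).
Proof. by rewrite act_imageE; exact: closed_act_preimage. Qed.

Lemma closure_act_image s A : closure (a s @` A) `<=` a s @` closure A.
Proof.
rewrite [X in _ `<=` X](closure_id _).1; last first.
  by apply: closed_act_image; exact: closed_closure.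
by apply: closureS; apply: image_subset; exact: subset_closure.
Qed.

(** The points whose orbit misses [A] form a closed invariant set that omits [x0], hence an empty
    one; compactness reduces the cover by translates of [A] to a finite set of times. *)
Lemma minimal_visits A :
  compact [set: X] -> minimal_action a -> open A -> A !=set0 ->
  exists E, forall x, exists2 e, e \in E & A (a e x).
Proof.
move=> cX minX oA [x0 Ax0].
pose C := [set x | forall s, ~ A (a s x)].
have [||C0|CT] := minX C.
- have -> : C = ~` \bigcup_(s in [set: G]) (a s @^-1` A).
    apply/seteqP; split=> x /=; first by move=> nA [s _]; exact: nA.
    by move=> nA s As; apply: nA; exists s.
  by apply: open_closedC; apply: bigcup_open => s _; exact: open_act_preimage.
- move=> s; rewrite act_imageE; apply/seteqP; split=> x /= Cx t.
    by have := Cx (t * s)%g; rewrite act_mul actVK.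
  by rewrite -act_mul; exact: Cx.
(* The covering form of compactness is stated for pointed spaces; [x0] serves as the point. *)
- pose X' : ptopologicalType := HB.pack (Topological.sort X) (isPointed.Build X x0).
  have : compact [set: X'] := cX.
  rewrite compact_cover => /(_ G setT (fun s => a s @^-1` A)) [||E _ cE].
  + by move=> s _; exact: open_act_preimage.
  + move=> x _; have : ~ C x by rewrite C0.
    by move=> /existsNP[s /contrapT As]; exists s.
  by exists E => x; have [s Es As] := cE x I; exists s.
- have : C x0 by rewrite CT.
  by move=> /(_ 1%g); rewrite act_one.
Qed.

End ActionTopology.

Lemma closed_open_interpolation (X : topologicalType) (A W : set X) :
  normal_space X -> closed A -> open W -> A `<=` W ->
  exists V, [/\ open V, A `<=` V & closure V `<=` W].
Proof.
move=> nX cA oW AW; have [|V AV VW] := nX A cA W.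
  by move=> x /AW Wx; exact: open_nbhs_nbhs.
exists (interior V); split; [exact: open_interior|exact: AV|].
by apply: subset_trans VW; apply: closureS; exact: interior_subset.
Qed.

Lemma open_separation (X : topologicalType) (J : finType) (p : J -> X)
    (O : set X) :
  hausdorff_space X -> @regular_space X -> injective p ->
  open O -> (forall i, O (p i)) ->
  exists D : J -> set X, [/\ forall i, open (D i), forall i, D i (p i),
    forall i, closure (D i) `<=` O &
    forall i j, i != j -> closure (D i) `&` closure (D j) = set0].
Proof.
rewrite open_hausdorff => hX rX pinj oO Op.
have sep i j : exists AB : set X * set X, [/\ open AB.1, open AB.2,
    AB.1 (p i), AB.2 (p j) & i != j -> AB.1 `&` AB.2 = set0].
  have [->|nij] := eqVneq i j.
    by exists (setT, setT); split => //=; exact: openT.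
  have /hX : p i != p j by apply: contra nij => /eqP/pinj ->.
  by case=> AB [pA pB] [opA opB /eqP AB0]; exists AB; split=> //; exact: set_mem.
have [AB ABP] := choice (fun ij => sep ij.1 ij.2).
(* [AB (i, j)] and [AB (j, i)] are chosen independently. Intersecting with one half of each lets the
   pair [(i, j)] alone separate [D0 i] from [D0 j]. *)
pose D0 i := O `&` \bigcap_(j in [set: J]) ((AB (i, j)).1 `&` (AB (j, i)).2).
have nbD0 i : nbhs (p i) (D0 i).
  apply: filterI; first exact: open_nbhs_nbhs.
  suff -> : \bigcap_(j in [set: J]) ((AB (i, j)).1 `&` (AB (j, i)).2) =
     [set x | forall j, (AB (i, j)).1 x /\ (AB (j, i)).2 x].
    apply: filter_forall => j.
    have [opA _ Ai _ _] := ABP (i, j); have [_ opB _ Bi _] := ABP (j, i).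
    by apply: filterI; apply: open_nbhs_nbhs.
  by apply/seteqP; split=> x xD j; [exact: xD | move=> _; exact: xD].
have /choice[D1 D1P] i : exists D1, nbhs (p i) D1 /\ closure D1 `<=` D0 i.
  by have [D1 D1p cD1] := rX _ _ (nbD0 i); exists D1.
exists (fun i => interior (D1 i)); split => [i|i|i|i j nij].
- exact: open_interior.
- exact: (D1P i).1.
- move=> x /(closureS (@interior_subset _ _)) /(D1P i).2 [] //.
- apply/seteqP; split=> // x [].
  move=> /(closureS (@interior_subset _ _)) /(D1P i).2 [_ /(_ j I) [xij _]].
  move=> /(closureS (@interior_subset _ _)) /(D1P j).2 [_ /(_ i I) [_ xij']].
  have [_ _ _ _ /(_ nij) AB0] := ABP (i, j).
  by have : (set0 : set X) x by rewrite -AB0.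
Qed.

(** * Borel sets and invariant measures *)

Section Borel.
Variable X : topologicalType.
Implicit Types A B : set X.

Lemma borel_open A : open A -> borel_set A.
Proof. exact: sub_sigma_algebra. Qed.

Lemma borel_setC A : borel_set A -> borel_set (~` A).
Proof.
rewrite -setTD; have [_ bC _] := smallest_sigma_algebra [set: X] open; exact: bC.
Qed.

Lemma borel_closed A : closed A -> borel_set A.
Proof.
move=> cA; rewrite -[A]setCK; apply: borel_setC; apply: borel_open.
exact: closed_openC.
Qed.

Lemma borel_bigcup (F : nat -> set X) :
  (forall i, borel_set (F i)) -> borel_set (\bigcup_i F i).
Proof. by have [_ _] := smallest_sigma_algebra [set: X] open; apply. Qed.

Lemma borel_set0 : borel_set (set0 : set X).
Proof. by apply: borel_open; exact: open0. Qed.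

Lemma borel_setU A B : borel_set A -> borel_set B -> borel_set (A `|` B).
Proof.
move=> bA bB; rewrite -bigcup2E; apply: borel_bigcup => -[|[|n]].
- exact: bA.
- exact: bB.
- exact: borel_set0.
Qed.

Lemma borel_setI A B : borel_set A -> borel_set B -> borel_set (A `&` B).
Proof.
move=> bA bB; rewrite -[A `&` B]setCK setCI; apply: borel_setC; apply: borel_setU;
  exact: borel_setC.
Qed.

Lemma borel_setD A B : borel_set A -> borel_set B -> borel_set (A `\` B).
Proof. by move=> bA bB; rewrite setDE; apply: borel_setI => //; exact: borel_setC. Qed.

End Borel.

Section Mass.
Variables (R : realType) (G : groupType) (X : topologicalType).
Variable a : topAction G X.
Implicit Types (mu : set X -> \bar R) (A B : set X).

(** Real values make the later estimates linear arithmetic; on Borel sets nothing is lost, by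
    [massE]. *)
Definition mass mu A : R := fine (mu A).

Variable mu : set X -> \bar R.
Hypothesis mu_inv : invariant_measures a mu.

Lemma massE A : borel_set A -> mu A = (mass mu A)%:E.
Proof.
case: mu_inv => -[p [P ->]] _ bA; rewrite /mass fineK//.
exact: (@fin_num_measure _ _ _ P).
Qed.

Lemma mass_ge0 A : 0 <= mass mu A.
Proof. by case: mu_inv => -[p [P ->]] _; apply: fine_ge0; exact: measure_ge0. Qed.

Lemma mass_setT : mass mu setT = 1.
Proof. by case: mu_inv => -[p [P ->]] _; rewrite /mass (probability_setT P). Qed.

Lemma mass_act s A : borel_set A -> mass mu (a s @` A) = mass mu A.
Proof. by case: mu_inv => _ + bA => /(_ s A bA); rewrite /mass => ->. Qed.

Lemma massU A B : borel_set A -> borel_set B -> A `&` B = set0 ->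
  mass mu (A `|` B) = mass mu A + mass mu B.
Proof.
move=> bA bB AB0; apply: EFin_inj; rewrite EFinD -!massE//; last exact: borel_setU.
by case: mu_inv => -[p [P ->]] _; rewrite (measureU P).
Qed.

Lemma mass_set0 : mass mu set0 = 0.
Proof. by case: mu_inv => -[p [P ->]] _; rewrite /mass measure0. Qed.

Lemma massD A B : borel_set A -> borel_set B -> B `<=` A ->
  mass mu (A `\` B) = mass mu A - mass mu B.
Proof.
move=> bA bB BA; rewrite -[in mass mu A](setDUK BA) massU ?setDIK//.
  by rewrite addrAC subrr add0r.
exact: borel_setD.
Qed.

Lemma le_mass A B : borel_set A -> borel_set B -> A `<=` B ->
  mass mu A <= mass mu B.
Proof. by move=> bA bB AB; rewrite -subr_ge0 -massD// mass_ge0. Qed.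

Lemma le_massU A B : borel_set A -> borel_set B ->
  mass mu (A `|` B) <= mass mu A + mass mu B.
Proof.
move=> bA bB; have bU := borel_setU bA bB; have bD := borel_setD bB bA.
have -> : A `|` B = A `|` (B `\` A).
  by rewrite setUDr setDv setD0.
by rewrite massU ?setDIK// lerD2l; apply: le_mass => // x [].
Qed.

Lemma mass_setC A : borel_set A -> mass mu (~` A) = 1 - mass mu A.
Proof.
move=> bA; rewrite -setTD massD ?mass_setT//.
by apply: borel_open; exact: openT.
Qed.

Section Sums.
Variables (I : choiceType) (F : I -> set X).
Hypothesis bF : forall i, borel_set (F i).

Lemma borel_bigcup_seq (s : seq I) : borel_set (\bigcup_(i in [set` s]) F i).
Proof.
rewrite bigcup_seq; elim/big_ind: _ => [|A B|i _].
- exact: borel_set0.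
- exact: borel_setU.
- exact: bF.
Qed.

Lemma le_mass_sum B (s : seq I) : borel_set B ->
  (forall x, B x -> exists2 i, i \in s & F i x) ->
  mass mu B <= \sum_(i <- s) mass mu (F i).
Proof.
move=> bB BF; apply: (@le_trans _ _ (mass mu (\bigcup_(i in [set` s]) F i))).
  by apply: le_mass => //; first exact: borel_bigcup_seq.
elim: s {BF} => [|i s IH].
  by rewrite big_nil (_ : [set` [::]] = set0) ?bigcup_set0 ?mass_set0//; apply/seteqP; split.
rewrite big_cons; apply: le_trans (lerD (lexx _) IH).
apply: le_trans (le_massU _ _); rewrite //; last exact: borel_bigcup_seq.
apply: le_mass; [exact: borel_bigcup_seq| |].
  by apply: borel_setU => //; exact: borel_bigcup_seq.
move=> x [j /=]; rewrite inE => /orP[/eqP -> ?|js Fj]; first by left.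
by right; exists j.
Qed.

Lemma sum_mass_le B (s : seq I) : borel_set B -> uniq s ->
  {in s, forall i, F i `<=` B} ->
  {in s &, forall i j, F i `&` F j !=set0 -> i = j} ->
  \sum_(i <- s) mass mu (F i) <= mass mu B.
Proof.
move=> bB; elim: s B bB => [|i s IH] B bB; first by rewrite big_nil mass_ge0.
rewrite /= => /andP[nis us] FB dF; rewrite big_cons.
have FiB : F i `<=` B by apply: FB; rewrite mem_head.
rewrite -lerBrDl -massD//; apply: IH => //; first exact: borel_setD.
  move=> j js x Fj; split; first by apply: FB Fj; rewrite in_cons js orbT.
  move=> Fi; suff ij : i = j by rewrite ij js in nis.
  by apply: dF; rewrite ?mem_head ?in_cons ?js ?orbT//; exists x.
by move=> j k js ks; apply: dF; rewrite in_cons ?js ?ks orbT.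
Qed.

End Sums.
End Mass.

(** * Cores of finite subsets of a group *)

Section FsetTools.
Variable T : choiceType.
Implicit Types (A B : {fset T}) (s : seq T).

Lemma leq_size_card s A : uniq s -> {subset s <= A} -> (size s <= #|` A|)%N.
Proof. exact: uniq_leq_size. Qed.

Lemma leq_card_size A s : {subset A <= s} -> (#|` A| <= size s)%N.
Proof. by move=> As; apply: uniq_leq_size => //; exact: fset_uniq. Qed.

Lemma fset_upper_bound (J : finType) (K : J -> {fset T}) :
  exists L : {fset T}, forall j, {subset K j <= L}.
Proof.
exists (\bigcup_(j <- enum J) K j)%fset => j x xK.
by apply/bigfcupP; exists j; rewrite ?mem_enum.
Qed.

End FsetTools.

Section Core.
Variables (R : realType) (G : groupType).
Implicit Types (E F K S T : {fset G}).

(** This is the intersection over E ∪ {e} in the definition of approximate invariance. Membership in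
    [F] plays the part of the identity, so that [E] need not contain it. *)
Definition core E F : {fset G} :=
  [fset t in F | all (fun s => (s * t)%g \in F) E]%fset.

Lemma coreP E F t :
  reflect (t \in F /\ forall s, s \in E -> (s * t)%g \in F) (t \in core E F).
Proof.
rewrite !inE /=; apply: (iffP andP) => -[tF H]; split=> //; last exact/allP.
by move=> s sE; have /allP := H; apply.
Qed.

Lemma core_sub E F : {subset core E F <= F}.
Proof. by move=> t /coreP[]. Qed.

Lemma coreS E E' F : {subset E <= E'} -> {subset core E' F <= core E F}.
Proof. by move=> EE' t /coreP[tF tE]; apply/coreP; split=> // s /EE'; exact: tE. Qed.

Lemma card_core E F : (#|` core E F| <= #|` F|)%N.
Proof. by apply: leq_card_size => t /core_sub. Qed.

Lemma card_sub_core E F :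
  #|` [fset t in F | t \notin core E F]%fset|%:R = #|` F|%:R - #|` core E F|%:R :> R.
Proof.
have -> : [fset t in F | t \notin core E F]%fset = (F `\` core E F)%fset.
  by apply/fsetP => t; rewrite !inE /= andbC.
rewrite cardfsD (_ : F `&` core E F = core E F)%fset.
  by rewrite natrB// card_core.
by apply/fsetIidPr/fsubsetP; exact: core_sub.
Qed.

Lemma approx_invariant_core E (delta : R) F :
  approx_invariant E delta F -> (1 - delta) * #|` F|%:R <= #|` core E F|%:R.
Proof.
rewrite /approx_invariant.
rewrite (_ : \bigcap_(s in _) _ = [set` core E F]) ?set_fsetK//.
apply/seteqP; split=> [t tE|t /coreP[tF tE] s] /=.
  apply/coreP; split=> [|s sE].
    by have [/=|u uF] := tE 1%g; rewrite ?fset1U1// invg1 mul1g => <-.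
  have [/=|u uF <-] := tE s; first by rewrite fset1Ur.
  by rewrite mulgA mulgV mul1g.
rewrite in_fset1U => /orP[/eqP ->|sE].
  by exists t => //; rewrite invg1 mul1g.
by exists (s * t)%g; [exact: tE|rewrite mulgA mulVg mul1g].
Qed.

(** The core is nonempty, and a point t of it gives a copy E t of [E] inside [F]. In an infinite
    group this forces shapes to be as large as desired. *)
Lemma invariant_card E (delta : R) F :
  delta < 1 -> F != fset0 -> (1 - delta) * #|` F|%:R <= #|` core E F|%:R ->
  (#|` E| <= #|` F|)%N.
Proof.
move=> d1 F0 FE.
have : 0 < #|` core E F|%:R :> R.
  apply: lt_le_trans FE; rewrite mulr_gt0 ?subr_gt0// ltr0n.
  by rewrite cardfs_gt0.
rewrite ltr0n cardfs_gt0 => /fset0Pn[t /coreP[_ tE]].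
rewrite -(size_map (fun s => (s * t)%g)); apply: leq_size_card.
  by rewrite map_inj_uniq ?fset_uniq//; exact: mulIg.
by move=> _ /mapP[s sE ->]; exact: tE.
Qed.

Definition fset_mul E F : {fset G} :=
  seq_fset tt [seq (s * t)%g | s <- enum_fset E, t <- enum_fset F].

Lemma mem_fset_mul E F s t : s \in E -> t \in F -> (s * t)%g \in fset_mul E F.
Proof. by move=> sE tF; rewrite seq_fsetE; apply: allpairs_f. Qed.

End Core.

(** * Tiling finite sets by the shapes of a castle *)

Lemma allpairs_uniq_fibers (A B C : eqType) (f : A -> B -> C) (s : seq A)
    (t : A -> seq B) :
  uniq s -> {in s, forall x, uniq (t x)} ->
  (forall x y x' y', x \in s -> y \in t x -> x' \in s -> y' \in t x' ->
     f x y = f x' y' -> x = x' /\ y = y') ->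
  uniq [seq f x y | x <- s, y <- t x].
Proof.
move=> us ut finj; apply: allpairs_uniq_dep => // -[x y] [x' y'].
move=> /allpairsPdep[u [v [us' vt /= /eqP]]]; rewrite -tag_eqE /tag_eq /= => /andP[/eqP xu].
rewrite {}xu tagged_asE => /eqP ->.
move=> /allpairsPdep[u' [v' [us'' vt' /= /eqP]]]; rewrite -tag_eqE /tag_eq /= => /andP[/eqP xu].
rewrite {}xu tagged_asE => /eqP -> /finj[]// -> ->.
by [].
Qed.

Lemma levels_inj (G : groupType) (X : topologicalType) (a : topAction G X)
    (J : finType) (S : J -> {fset G}) (W : J -> set X) k t w k' t' w' :
  castle a S W -> t \in S k -> t' \in S k' -> W k w -> W k' w' ->
  a t w = a t' w' -> [/\ k = k', t = t' & w = w'].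
Proof.
move=> cSW tS tS' Ww Ww' e.
have kk : k = k'.
  apply: cSW.2 => //; exists (a t w).
  by split; [exists t => //; exists w|exists t' => //; exists w'].
subst k'; have [_ _ tr] := cSW.1 k.
have tt : t = t' by apply: tr => //; exists (a t w); split; [exists w|exists w'].
by subst t'; split=> //; exact: act_inj e.
Qed.

Section Tiles.
Variables (R : realType) (G : groupType) (X : topologicalType).
Variables (a : topAction G X) (J : finType) (T : J -> {fset G}) (V : J -> set X).
Hypothesis cTV : castle a T V.
Variable x : X.
Implicit Types (E F : {fset G}) (j : J) (c t : G) (z : J * G).

(** Applied to [x], the two group elements land in castle levels, so disjointness of the levels in
    the space becomes disjointness of the tiles T_j c in the group. *)
Lemma tile_inj j c t j' c' t' : t \in T j -> t' \in T j' ->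
  V j (a c x) -> V j' (a c' x) -> (t * c = t' * c')%g ->
  [/\ j = j', t = t' & c = c'].
Proof.
move=> tT tT' Vc Vc' tc; have := congr1 (fun g => a g x) tc; rewrite !act_mul => e.
have [jj tt _] := levels_inj cTV tT tT' Vc Vc' e; subst j' t'.
by split=> //; exact: mulgI tc.
Qed.

(** Return times of [x] to the base [V j] whose whole tile T_j c stays in [F]. The ambient product
    only provides finiteness: as [T j] is nonempty, it contains every such c. *)
Definition centers F j : {fset G} :=
  [fset c in fset_mul [fset t^-1 | t in T j] F |
    `[< V j (a c x) >] && all (fun t => t * c \in F) (T j)]%g%fset.

Lemma centersP F j c : reflect
  (V j (a c x) /\ forall t, t \in T j -> (t * c)%g \in F) (c \in centers F j).
Proof.
apply: (iffP idP).
  by rewrite !inE /= => /andP[_ /andP[/asboolP Vc /allP]].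
move=> [Vc cF]; rewrite !inE /=; apply/andP; split; last first.
  by apply/andP; split; [exact/asboolP|exact/allP].
have [/fset0Pn[t tT] _ _] := cTV.1 j.
rewrite -[c](mulKg t); apply: mem_fset_mul; last exact: cF.
by apply/imfsetP; exists t.
Qed.

Definition tiles (S : J -> {fset G}) (zs : seq (J * G)) : seq G :=
  [seq (t * z.2)%g | z <- zs, t <- enum_fset (S z.1)].

Lemma size_tiles S zs : size (tiles S zs) = (\sum_(z <- zs) #|` S z.1|)%N.
Proof. by rewrite /tiles size_allpairs_dep sumnE big_map. Qed.

Lemma uniq_tiles S zs F : (forall j, {subset S j <= T j}) -> uniq zs ->
  {in zs, forall z, z.2 \in centers F z.1} -> uniq (tiles S zs).
Proof.
move=> ST uz zF; apply: allpairs_uniq_fibers => // [z _|[j c] t [j' c'] t' /=].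
  exact: fset_uniq.
move=> /zF/centersP[/= Vc _] /ST tT /zF/centersP[/= Vc' _] /ST tT'.
by move=> /(tile_inj tT tT' Vc Vc')[-> -> ->].
Qed.

(** If s x is not in the remainder, it lies in some level t V_j, and t^-1 s is a center: its tile is
    contained in T_j T_j^-1 s, which stays in [F] because s is in the [K]-core. *)
Lemma card_le_tiles F (K : {fset G}) :
  (forall j t t', t \in T j -> t' \in T j -> (t * t'^-1)%g \in K) ->
  (#|` core K F| <= #|` [fset s in core K F | `[< castle_remainder a T V (a s x) >]]%fset|
     + \sum_j #|` centers F j| * #|` T j|)%N.
Proof.
move=> TK; pose zs := [seq (j, c) | j <- enum J, c <- enum_fset (centers F j)].
have -> : (\sum_j #|` centers F j| * #|` T j| = size (tiles T zs))%N.
  rewrite size_tiles big_allpairs_dep /= big_enum; apply: eq_bigr => j _.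
  by rewrite big_const_seq count_predT iter_addn_0 mulnC.
rewrite -size_cat; apply: leq_card_size => s sK; rewrite mem_cat.
have [sR|/contrapT[j _ [t tT]]] := pselect (castle_remainder a T V (a s x)).
  apply/orP; left; apply/imfsetP; exists s => //=.
  by apply/andP; split=> //; exact/asboolP.
rewrite act_imageE /= -act_mul => Vc; apply/orP; right.
apply/allpairsPdep; exists (j, (t^-1 * s)%g), t; split=> //=; last by rewrite mulVKg.
apply/allpairsPdep; exists j, (t^-1 * s)%g; split=> //; first by rewrite mem_enum.
apply/centersP; split=> // t' tT'; rewrite mulgA.
by have /coreP[_] := sK; apply; exact: (TK j).
Qed.

End Tiles.

Lemma equal_chunks (T : eqType) (s : seq T) (I : finType) : uniq s ->
  exists c : I -> seq T, [/\ forall b, size (c b) = (size s %/ #|I|)%N,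
    forall b, uniq (c b), forall b, {subset c b <= s} &
    forall b b' x, x \in c b -> x \in c b' -> b = b'].
Proof.
case: s => [_|x0 s']; first by exists (fun=> [::]); split=> //= b; rewrite div0n.
move: (x0 :: s') => s us; set q := (size s %/ #|I|)%N.
(* Consecutive blocks of length [q]; the last [size s] mod [#|I|] entries are dropped. *)
pose pos (b : I) i := (enum_rank b * q + i)%N.
have pos_lt b i : (i < q)%N -> (pos b i < size s)%N.
  move=> iq; apply: (@leq_trans (#|I| * q)); last by rewrite mulnC leq_trunc_div.
  apply: (@leq_trans ((enum_rank b).+1 * q)); first by rewrite /pos mulSn addnC ltn_add2r.
  by rewrite leq_mul2r ltn_ord orbT.
have pos_inj b b' i i' : (i < q)%N -> (i' < q)%N ->
    nth x0 s (pos b i) = nth x0 s (pos b' i') -> b = b' /\ i = i'.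
  move=> iq iq' /eqP; rewrite nth_uniq ?pos_lt// => /eqP pp.
  have q0 : (0 < q)%N by apply: leq_ltn_trans iq.
  have := congr1 (divn^~ q) pp; rewrite /pos /= !divnMDl// !divn_small// !addn0.
  move=> /ord_inj/enum_rank_inj bb; split=> //.
  by move: pp; rewrite bb => /addnI.
exists (fun b => [seq nth x0 s (pos b i) | i <- iota 0 q]); split.
- by move=> b; rewrite size_map size_iota.
- move=> b; rewrite map_inj_in_uniq ?iota_uniq// => i i'.
  by rewrite !mem_iota /= => iq iq' /pos_inj[].
- by move=> b _ /mapP[i + ->]; rewrite mem_iota /= => iq; rewrite mem_nth ?pos_lt.
- move=> b b' _ /mapP[i + ->] /mapP[i' + ii']; rewrite !mem_iota /= => iq iq'.
  by have [] := pos_inj _ _ _ _ iq iq' ii'.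
Qed.

Section TileBins.
Variables (G : groupType) (X : topologicalType) (a : topAction G X).
Variables (J : finType) (T : J -> {fset G}) (V : J -> set X).
Hypothesis cTV : castle a T V.
Variables (x : X) (I : finType) (E F : {fset G}).
Hypotheses (I0 : (0 < #|I|)%N) (E1 : 1%g \in E).

(* Each bin receives the same number of tiles of each shape, and only their
   [E]-cores, so that saturating by [E] stays inside the tiles. *)
Lemma tile_bins : exists (D : I -> {fset G}) (q : J -> nat),
  [/\ forall j, (#|` centers a T V x F j| <= q j * #|I| + #|I|)%N,
      forall b, #|` D b| = (\sum_j q j * #|` core E (T j)|)%N,
      forall b, (\sum_j q j * #|` core (fset_mul E E) (T j)| <= #|` core E (D b)|)%N,
      forall b e t, e \in E -> t \in D b -> (e * t)%g \in F &
      forall b b' e e' t t', e \in E -> e' \in E -> t \in D b -> t' \in D b' ->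
        (e * t = e' * t')%g -> b = b'].
Proof.
pose Z j := centers a T V x F j.
have /choice[ch chP] j := @equal_chunks _ (enum_fset (Z j)) I (fset_uniq _).
pose q j := (#|` Z j| %/ #|I|)%N.
pose zs b := [seq (j, c) | j <- enum J, c <- ch j b].
have zsF b : {in zs b, forall z, z.2 \in Z z.1}.
  move=> _ /allpairsPdep[j [c [_ cj ->]]] /=.
  by have [_ _ cs _] := chP j; exact: cs cj.
have uzs b : uniq (zs b).
  apply: allpairs_uniq_fibers; rewrite ?enum_uniq//.
    by move=> j _; have [_ u _ _] := chP j.
  by move=> j c j' c' _ _ _ _ [-> ->].
have sumzs b (f : J -> nat) : (\sum_(z <- zs b) f z.1 = \sum_j q j * f j)%N.
  rewrite big_allpairs_dep /= big_enum; apply: eq_bigr => j _.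
  rewrite big_const_seq count_predT iter_addn_0 mulnC; congr (_ * _)%N.
  by have [-> _ _ _] := chP j.
have coreT E' j : {subset core E' (T j) <= T j} by move=> t /core_sub.
pose D b := seq_fset tt (tiles (fun j => core E (T j)) (zs b)).
exists D, q; split.
- move=> j; rewrite {1}(divn_eq #|` Z j| #|I|) leq_add2l ltnW// ltn_mod//.
- move=> b; rewrite size_seq_fset undup_id; last first.
    by apply: (uniq_tiles cTV) (uzs b) (zsF b) => j; exact: coreT.
  by rewrite size_tiles; exact: (sumzs b (fun j => #|` core E (T j)|%fset)).
(* Bins consist of [E]-cores of tiles, so their own [E]-cores require two applications of [E]: a
   point of the E E-core of a tile is moved by [E] into the [E]-core of that tile. *)
- move=> b; pose EE j := core (fset_mul E E) (T j).
  rewrite -(sumzs b (fun j => #|` EE j|%fset)) -(size_tiles EE).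
  apply: leq_size_card.
    by apply: (uniq_tiles cTV) (uzs b) (zsF b) => j; exact: coreT.
  move=> _ /allpairsPdep[[j c] [t [/= zb /coreP[tT tE] ->]]].
  have tcore e : e \in E -> (e * t)%g \in core E (T j).
    move=> eE; apply/coreP; split=> [|e' eE'].
      by rewrite -[e]mul1g; apply: tE; exact: mem_fset_mul.
    by rewrite mulgA; apply: tE; exact: mem_fset_mul.
  have tcD e : e \in E -> (e * (t * c))%g \in D b.
    move=> eE; rewrite seq_fsetE mulgA; apply/allpairsPdep.
    by exists (j, c), (e * t)%g; split=> //; exact: tcore.
  by apply/coreP; split=> //; rewrite -[(t * c)%g]mul1g; exact: tcD.
- move=> b e t eE; rewrite seq_fsetE => /allpairsPdep[[j c] [u [/= zb /coreP[_ uE] ->]]].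
  have /centersP-/(_ cTV)[_ cF] := zsF _ _ zb.
  by rewrite mulgA; apply: cF; exact: uE.
- move=> b b' e e' t t' eE eE'; rewrite !seq_fsetE.
  move=> /allpairsPdep[[j c] [u [/= zb /coreP[_ uE] ->]]].
  move=> /allpairsPdep[[j' c'] [u' [/= zb' /coreP[_ uE'] ->]]].
  have /(centersP cTV)[/= Vc _] := zsF _ _ zb.
  have /(centersP cTV)[/= Vc' _] := zsF _ _ zb'.
  rewrite !mulgA => /(tile_inj cTV (uE _ eE) (uE' _ eE') Vc Vc')[jj _ cc].
  move: zb zb'; rewrite -jj -cc.
  move=> /allpairsPdep[j1 [c1 [_ cb [-> ->]]]] /allpairsPdep[j2 [c2 [_ + [e1 e2]]]].
  by subst j2 c2 => cb'; have [_ _ _] := chP j1; apply; [exact: cb|exact: cb'].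
Qed.

End TileBins.

(** * Consequences of the uniform Rokhlin property and comparison *)

Section Dynamics.
Variables (R : realType) (G : groupType) (X : metricType R).
Variable a : topAction G X.
Hypotheses (cX : compact [set: X]) (minX : minimal_action a).
Hypotheses (infG : infinite_set [set: G]).
Hypotheses (urpX : uniform_Rokhlin_property a R) (cmpX : comparison a R).
Variable x0 : X.
Implicit Types (mu : set X -> \bar R) (A B O : set X) (E : {fset G}).

Lemma subequivalent_mass A B : closed A -> open B ->
  (forall mu, invariant_measures a mu -> mass mu A < mass mu B) ->
  subequivalent a A B.
Proof.
move=> cA oB AB; apply: cmpX => // mu mu_inv.
rewrite !(massE mu_inv) ?lte_fin; [exact: AB|exact: borel_open|exact: borel_closed].
Qed.

(* Otherwise comparison would hold vacuously for [X] and the empty set. *)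
Lemma invariant_measure_exists : exists mu, invariant_measures a mu.
Proof.
apply: contrapT => no_mu.
have [n [U [s [_ cU _ sU0]]]] : subequivalent a [set: X] set0.
  apply: cmpX; [exact: closedT|exact: open0|].
  by move=> mu mu_inv; case: no_mu; exists mu.
have [i _ Ui] := cU x0 I.
by apply: (sU0 i (a (s i) x0)); exists x0.
Qed.

Lemma open_castle_exists E (delta : R) : 0 < delta ->
  exists (K : finType) (S : K -> {fset G}) (V : K -> set X),
    [/\ castle a S V, forall k, open (V k),
      forall k, (1 - delta) * #|` S k|%:R <= #|` core E (S k)|%:R,
      closed (castle_remainder a S V) &
      forall mu, invariant_measures a mu ->
        mass mu (castle_remainder a S V) < delta].
Proof.
move=> d0; have [K [S [V [cSV oSV SE mR]]]] := urpX E d0.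
exists K, S, V; split=> // [k|k||mu mu_inv].
- have [/fset0Pn[s sS] _ _] := cSV.1 k.
  have := open_act_image a s^-1%g (oSV k s sS).
  by rewrite act_imageM mulVg act_image1.
- exact: approx_invariant_core.
- apply: open_closedC; apply: bigcup_open => k _.
  by apply: bigcup_open => s; exact: oSV.
- have bR : borel_set (castle_remainder a S V).
    apply: borel_setC; apply: borel_open; apply: bigcup_open => k _.
    by apply: bigcup_open => s; exact: oSV.
  rewrite -lte_fin -(massE mu_inv)//; apply: le_lt_trans mR.
  by apply: ereal_sup_ubound; exists mu.
Qed.

(** Infinitude of [G] does not by itself exclude finite orbits. A castle with shapes of at least n
    elements does: by minimality the orbit enters a base, and the levels of its tower then separate
    n points. *)
Lemma orbit_infinite n x : exists s : 'I_n -> G, injective (fun i => a (s i) x).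
Proof.
have [E _ nE] := infinite_set_fset n infG.
have half0 : 0 < 2^-1 :> R by rewrite invr_gt0.
have [K [S [V [cSV oV SE _ mR]]]] := open_castle_exists E half0.
have [mu mu_inv] := invariant_measure_exists.
(* Without towers the remainder would be all of [X], of mass 1 rather than below 1/2. *)
have [k] : exists k : K, True.
  apply: contrapT => noK.
  have := mR _ mu_inv; rewrite (_ : castle_remainder a S V = setT).
    by rewrite (mass_setT mu_inv); lra.
  by apply/seteqP; split=> // y _ [k]; case: noK; exists k.
have [Sk0 V0 trk] := cSV.1 k.
have [E' E'P] := minimal_visits cX minX (oV k) V0.
have [g _ gx] := E'P x.
have nS : (n <= #|` S k|)%N.
  by apply: leq_trans nE _; apply: invariant_card Sk0 (SE k); lra.
move=> _; exists (fun i => nth 1%g (S k) i * g)%g => i j.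
rewrite !act_mul => ij; apply: val_inj; apply/eqP.
have li (l : 'I_n) : (l < size (S k))%N by apply: leq_trans nS.
rewrite -(nth_uniq 1%g (li i) (li j) (fset_uniq _)); apply/eqP.
apply: trk; [exact: mem_nth|exact: mem_nth|].
exists (a (nth 1%g (S k) i) (a g x)); split; first by exists (a g x).
by exists (a g x).
Qed.

(** Finitely many translates of [A] cover [X] and all have the same mass, so the reciprocal of their
    number is a bound independent of the measure. *)
Lemma mass_lower_bound A : open A -> A !=set0 ->
  exists2 eta : R, 0 < eta &
    forall mu, invariant_measures a mu -> eta <= mass mu A.
Proof.
move=> oA A0; have [E EP] := minimal_visits cX minX oA A0.
have [e eE _] := EP x0.
have E0 : 0 < #|` E|%:R :> R.
  by rewrite ltr0n cardfs_gt0; apply/fset0Pn; exists e.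
exists #|` E|%:R^-1; first by rewrite invr_gt0.
move=> mu mu_inv; rewrite -[leLHS]mul1r ler_pdivrMr// -[leLHS](mass_setT mu_inv).
have oeA s : open (a s @` A) by exact: open_act_image.
apply: (@le_trans _ _ (\sum_(s <- enum_fset E) mass mu (a s^-1%g @` A))).
  apply: (le_mass_sum mu_inv) => [s||x _].
  - exact: borel_open.
  - by apply: borel_open; exact: openT.
  - have [s sE sx] := EP x; exists s => //.
    by rewrite act_imageE /= invgK.
under eq_bigr => s _ do rewrite (mass_act mu_inv _ (borel_open oA)).
by rewrite big_const_seq count_predT iter_addr_0 mulr_natr.
Qed.

(** Around n distinct points of the orbit of [x] there are neighborhoods with disjoint closures. A
    neighborhood of [x] whose closure is carried into all of them has n disjoint translates of its
    closure, of total mass at most 1. *)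
Lemma small_neighborhood x O n : open O -> O x ->
  exists D, [/\ open D, D x, closure D `<=` O &
    forall mu, invariant_measures a mu -> n%:R * mass mu (closure D) <= 1].
Proof.
move=> oO Ox; have [s s_inj] := orbit_infinite n x.
have [//|D [oD Dx _ cD]] := open_separation (@metric_hausdorff _ _) uniform_regular s_inj openT.
pose D' := O `&` [set y | forall i, D i (a (s i) y)].
have [N Nx ND] : exists2 N, nbhs x N & closure N `<=` D'.
  apply: uniform_regular; apply: filterI; first exact: open_nbhs_nbhs.
  apply: filter_forall => i; apply: open_nbhs_nbhs; split; last exact: Dx.
  by have := open_act_preimage a (s i) (oD i).
exists (interior N); have iD : closure (interior N) `<=` D'.
  by apply: subset_trans ND; apply: closureS; exact: interior_subset.
split; [exact: open_interior|exact: Nx|by move=> y /iD[]|].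
move=> mu mu_inv; rewrite -[leRHS](mass_setT mu_inv).
have bN : closed (closure (interior N)) by exact: closed_closure.
apply: (@le_trans _ _ (\sum_(i <- enum 'I_n) mass mu (a (s i) @` closure (interior N)))).
  under eq_bigr => i _ do rewrite (mass_act mu_inv _ (borel_closed bN)).
  by rewrite big_const_seq count_predT iter_addr_0 size_enum_ord mulr_natl.
apply: (sum_mass_le mu_inv) => [i|||//|i j _ _ [y [[u uN <-] [v vN uv]]]].
- by apply: borel_closed; exact: closed_act_image.
- by apply: borel_open; exact: openT.
- exact: enum_uniq.
- apply/eqP; apply: contraT => nij.
  have : (closure (D i) `&` closure (D j)) (a (s i) u).
    split; first by apply: subset_closure; exact: (iD _ uN).2.
    by rewrite -uv; apply: subset_closure; exact: (iD _ vN).2.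
  by rewrite cD.
Qed.

(** The open sets witnessing the subequivalence already form a neighborhood of [A], and their
    disjoint translates fit in [B]. The bound is thus uniform in the measure. *)
Lemma subequivalent_thickening A B : borel_set B -> subequivalent a A B ->
  exists N, [/\ open N, A `<=` N &
    forall mu, invariant_measures a mu -> mass mu N <= mass mu B].
Proof.
move=> bB [n [U [s [oU AU trU UB]]]]; exists (\bigcup_i U i).
have oN : open (\bigcup_i U i) by apply: bigcup_open => i _; exact: oU.
split=> // mu mu_inv.
have bU i : borel_set (U i) by exact: borel_open.
apply: (@le_trans _ _ (\sum_(i <- enum 'I_n) mass mu (U i))).
  apply: (le_mass_sum mu_inv) => //; first exact: borel_open.
  by move=> x [i _ Ui]; exists i; rewrite ?mem_enum.
under eq_bigr => i _ do rewrite -(mass_act mu_inv (s i) (bU i)).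
apply: (sum_mass_le mu_inv) => // [i||i j _ _].
- by apply: borel_open; exact: open_act_image.
- exact: enum_uniq.
- exact: trU.
Qed.

(** A pointwise form suited to counting along a single orbit. Equal images lie in the same
    translated piece by disjointness, hence come from the same group element. *)
Lemma subequivalent_selection A B : subequivalent a A B ->
  exists (sel : X -> G) (K : {fset G}),
    (forall y, A y -> sel y \in K /\ B (a (sel y) y)) /\
    (forall y z, A y -> A z -> a (sel y) y = a (sel z) z -> sel y = sel z).
Proof.
move=> [n [U [s [_ AU trU UB]]]].
(* Outside [A] the value 1 is a mere default. *)
have /choice[i iP] y : exists g, A y -> exists2 i, g = s i & U i y.
  have [/AU[i _ Ui]|nA] := pselect (A y); last by exists 1%g.
  by exists (s i) => _; exists i.
exists i, (seq_fset tt [seq s j | j <- enum 'I_n]); split.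
  move=> y /iP[j -> Uj]; split; last by apply: (UB j); exists y.
  by rewrite seq_fsetE map_f// mem_enum.
move=> y z /iP[j -> Uj] /iP[k -> Uk] e; congr (s _); apply: trU => //.
by exists (a (s j) y); split; [exists y|exists z].
Qed.

(* If [s x] lies in [A] then for every [i] the piece of [A] containing it is
   carried by some [t] into [B i], and [(i, s) |-> t * s] is injective. *)
Lemma visits_sparse (I : finType) A (B : I -> set X) :
  trivIset setT B -> (forall i, subequivalent a A (B i)) ->
  exists K : {fset G}, forall (F : {fset G}) x,
    (#|I| * #|` [fset s in core K F | `[< A (a s x) >]]%fset| <= #|` F|)%N.
Proof.
move=> trB AB.
have /choice[sel selP] i := subequivalent_selection (AB i).
have /choice[L LP] := selP.
have [K KP] := fset_upper_bound L.
exists K => F x; set D := [fset s in _ | _]%fset.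
have DP s : s \in D -> A (a s x) /\ s \in core K F.
  by rewrite /D => /imfsetP[t /= /andP[tK /asboolP tA] ->].
have -> : (#|I| * #|` D| =
    size [seq (sel i (a s x) * s)%g | i <- enum I, s <- enum_fset D])%N.
  by rewrite size_allpairs -cardE.
apply: leq_size_card; last first.
  move=> _ /allpairsP[[i s] [_ /DP[As /coreP[_ sK]] ->]] /=.
  by apply: sK; apply: (KP i); have [] := (LP i).1 _ As.
apply: allpairs_uniq_fibers; [exact: enum_uniq|by move=> *; exact: fset_uniq|].
move=> i s j t _ /DP[As _] _ /DP[At _] e.
have eqx : a (sel i (a s x)) (a s x) = a (sel j (a t x)) (a t x).
  by rewrite -!act_mul e.
have ij : i = j.
  apply: trB => //; exists (a (sel i (a s x)) (a s x)); split.
    by have [] := (LP i).1 _ As.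
  by rewrite eqx; have [] := (LP j).1 _ At.
subst j; split=> //; move: e.
by rewrite ((LP i).2 _ _ As At eqx) => /mulgI.
Qed.

End Dynamics.

Lemma positive_lower_bound (R : realType) (I : finType) (f : I -> R) :
  (forall i, 0 < f i) -> exists2 eta, 0 < eta & forall i, eta <= f i.
Proof.
(* The initial value 1 keeps the bound positive when [I] is empty. *)
move=> f0; exists (\big[Num.min/1]_i f i); last by move=> i; exact: bigmin_le.
by elim/big_ind: _ => // x y x0 y0; rewrite lt_min x0.
Qed.

(** * Splitting invariant finite sets into equal separated bins *)

Section Bins.
Variables (R : realType) (G : groupType) (X : metricType R).
Variable a : topAction G X.
Hypotheses (cX : compact [set: X]) (minX : minimal_action a).
Hypotheses (infG : infinite_set [set: G]).
Hypotheses (urpX : uniform_Rokhlin_property a R) (cmpX : comparison a R).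
Variable x0 : X.
Implicit Types E F K : {fset G}.

(** Disjoint open sets around n points of one orbit have a common lower mass bound [eta]. A castle
    whose remainder has mass below [eta] has, by comparison, its remainder subequivalent to each of
    them, so visits to it occupy at most 1/n of an invariant set. *)
Lemma sparse_remainder_castle E (delta : R) n : 0 < delta ->
  exists (J : finType) (T : J -> {fset G}) (V : J -> set X),
    [/\ castle a T V,
      forall j, (1 - delta) * #|` T j|%:R <= #|` core E (T j)|%:R &
      exists K, forall F x, (n * #|` [fset s in core K F |
        `[< castle_remainder a T V (a s x) >]]%fset| <= #|` F|)%N].
Proof.
move=> d0; have [s s_inj] := orbit_infinite cX minX infG urpX cmpX x0 n x0.
have [//|B [oB Bx _ cB]] := open_separation (@metric_hausdorff _ _) uniform_regular s_inj openT.
have B0 i : B i !=set0 by exists (a (s i) x0).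
have /choice[f fP] i : exists eta : R, 0 < eta /\
    forall mu, invariant_measures a mu -> eta <= mass mu (B i).
  have [eta eta0 etaB] := mass_lower_bound cX minX x0 (oB i) (B0 i).
  by exists eta.
have [eta eta0 etaf] := positive_lower_bound (fun i => (fP i).1).
have dd : 0 < Num.min delta eta by rewrite lt_min d0.
have [J [T [V [cTV _ TE cR mR]]]] := open_castle_exists urpX E dd.
exists J, T, V; split=> // [j|].
  apply: le_trans (TE j); apply: ler_wpM2r => //.
  by rewrite lerD2l lerN2 ge_min lexx.
have trB : trivIset setT B.
  move=> i j _ _ [y [Bi Bj]]; apply/eqP; apply: contraT => nij.
  have : (closure (B i) `&` closure (B j)) y by split; exact: subset_closure.
  by rewrite cB.
have RB i : subequivalent a (castle_remainder a T V) (B i).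
  apply: (subequivalent_mass cmpX cR (oB i)) => mu mu_inv.
  apply: lt_le_trans (mR _ mu_inv) _; apply: le_trans ((fP i).2 _ mu_inv).
  by rewrite ge_min etaf orbT.
have [K KP] := visits_sparse trB RB.
by exists K => F x; have := KP F x; rewrite card_ord.
Qed.

Lemma equal_bins E (I : finType) (eps : R) :
  1%g \in E -> (0 < #|I|)%N -> 0 < eps -> eps < 1 ->
  exists K (delta : R), 0 < delta /\ forall F, F != fset0 ->
    (1 - delta) * #|` F|%:R <= #|` core K F|%:R ->
    exists (D : I -> {fset G}) (m : nat),
    [/\ forall b, #|` D b| = m,
      forall b e t, e \in E -> t \in D b -> (e * t)%g \in F,
      forall b b' e e' t t', e \in E -> e' \in E -> t \in D b -> t' \in D b' ->
        (e * t = e' * t')%g -> b = b' &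
      (1 - eps) * #|` F|%:R <= \sum_b #|` core E (D b)|%:R].
Proof.
(* Four losses of proportion at most [d] occur: passing to the [K]-core of [F], visits to the
   remainder, rounding to equally many tiles per bin, and passing to cores of tiles. The fifth [d]
   is slack. *)
move=> E1 I0 eps0 eps1; pose d := eps / 5.
have d0 : 0 < d by rewrite /d; lra.
have [n nd] : exists n : nat, 1 <= n%:R * d.
  exists (Num.bound d^-1); rewrite -ler_pdivrMr// div1r ltW//.
  by apply: archi_boundP; rewrite invr_ge0 ltW.
have [J [T [V [cTV TE [K1 K1P]]]]] := sparse_remainder_castle (fset_mul E E) n d0.
pose M := (\sum_j #|` T j|)%N.
(* Rounding loses at most [#|I|] tiles of each shape, hence at most [#|I| * M] elements. Containing
   [K2] makes [F] at least n times larger than that. *)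
have [K2 _ K2P] := infinite_set_fset (n * (#|I| * M)) infG.
have [K3 K3P] := fset_upper_bound
  (fun j => fset_mul (T j) [fset t^-1 | t in T j]%g%fset).
exists (K1 `|` K2 `|` K3)%fset, d; split=> // F F0 FK; set K := (_ `|` _)%fset in FK.
have K1K : {subset K1 <= K} by move=> s sK; rewrite !inE sK.
have K2K : {subset K2 <= K} by move=> s sK; rewrite !inE sK orbT.
have K3K : {subset K3 <= K} by move=> s sK; rewrite !inE sK orbT.
have cardF : (n * (#|I| * M) <= #|` F|)%N.
  apply: leq_trans K2P _; apply: leq_trans (leq_size_card (fset_uniq _) K2K) _.
  by apply: invariant_card F0 FK; rewrite /d; lra.
have [D [q [Zq Dq Dcore DF Ddisj]]] := tile_bins cTV x0 F I0 E1.
exists D, (\sum_j q j * #|` core E (T j)|)%N; split=> //.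
pose rem K' := [fset s in core K' F | `[< castle_remainder a T V (a s x0) >]]%fset.
have cov : (#|` core K F| <= #|` rem K| + \sum_j #|` centers a T V x0 F j| * #|` T j|)%N.
  apply: (card_le_tiles cTV) => j t t' tT tT'; apply: K3K; apply: (K3P j).
  by apply: mem_fset_mul => //; apply/imfsetP; exists t'.
have remK : (#|` rem K| <= #|` rem K1|)%N.
  apply: leq_size_card => // s /imfsetP[t /= /andP[tK tR] ->].
  by apply/imfsetP; exists t => //=; rewrite inE /= (coreS K1K tK) tR.
have remn : (n * #|` rem K| <= #|` F|)%N.
  by apply: leq_trans (K1P F x0); rewrite leq_mul2l remK orbT.
pose Q := (\sum_j q j * #|` T j|)%N.
have ZQ : (\sum_j #|` centers a T V x0 F j| * #|` T j| <= #|I| * Q + #|I| * M)%N.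
  rewrite !big_distrr /= -big_split /=; apply: leq_sum => j _.
  by rewrite mulnA -mulnDl (mulnC #|I|) leq_mul2r Zq orbT.
have coreQ : (1 - d) * Q%:R <= (\sum_j q j * #|` core (fset_mul E E) (T j)|)%N%:R.
  rewrite !natr_sum mulr_sumr; apply: ler_sum => j _.
  by rewrite !natrM mulrCA; apply: ler_wpM2l => //; exact: TE.
have sumD : #|I|%:R * (\sum_j q j * #|` core (fset_mul E E) (T j)|)%N%:R
    <= \sum_b #|` core E (D b)|%:R :> R.
  rewrite mulr_natl -sumr_const; apply: ler_sum => b _.
  by rewrite ler_nat; exact: Dcore.
apply: le_trans sumD.
apply: (@le_trans _ _ (#|I|%:R * ((1 - d) * Q%:R))); last by apply: ler_wpM2l.
move: cov remn ZQ cardF; rewrite -!(ler_nat R) !natrD !natrM.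
set f := #|` F|%:R; set c := #|` core K F|%:R; set v := #|` rem K|%:R.
set Zs := (\sum_j _)%N%:R; set N := #|I|%:R.
rewrite -/f -/c in FK.
have f0 : 0 <= f by rewrite /f.
have v0 : 0 <= v by rewrite /v.
have NM0 : 0 <= N * M%:R by rewrite /N mulr_ge0.
move=> cov remn ZQ cardF.
have vf : v <= d * f.
  apply: (@le_trans _ _ (n%:R * d * v)); first by rewrite ler_peMl.
  rewrite mulrAC mulrC; apply: ler_wpM2l => //; exact: ltW.
have NMf : N * M%:R <= d * f.
  apply: (@le_trans _ _ (n%:R * d * (N * M%:R))); first by rewrite ler_peMl.
  rewrite mulrAC mulrC; apply: ler_wpM2l => //; exact: ltW.
have NQ : (1 - 3 * d) * f <= N * Q%:R by lra.
rewrite mulrCA; apply: (@le_trans _ _ ((1 - d) * ((1 - 3 * d) * f))).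
  rewrite mulrA; apply: ler_wpM2r => //; have : 0 <= d * d by apply: mulr_ge0; exact: ltW.
  have : eps = 5 * d by rewrite /d; lra.
  by move=> ->; lra.
by apply: ler_wpM2l => //; rewrite /d; lra.
Qed.

End Bins.

(** * Masses of castle levels *)

Lemma ler_sum_subset (R : numDomainType) (T : eqType) (s t : seq T) (f : T -> R) :
  (forall x, 0 <= f x) -> uniq s -> {subset s <= t} ->
  \sum_(x <- s) f x <= \sum_(x <- t) f x.
Proof.
move=> f0; elim: s t => [|x s IH] t /=; first by rewrite big_nil sumr_ge0.
move=> /andP[xs us] st; have xt : x \in t by apply: st; rewrite mem_head.
rewrite (perm_big _ (perm_to_rem xt)) !big_cons lerD2l; apply: IH => // y ys.
have : y \in t by apply: st; rewrite in_cons ys orbT.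
rewrite (perm_mem (perm_to_rem xt)) in_cons => /orP[/eqP yx|//].
by rewrite -yx ys in xs.
Qed.

Lemma sumr_const_fset (R : pzSemiRingType) (T : choiceType) (A : {fset T}) (x : R) :
  \sum_(t <- enum_fset A) x = #|` A|%:R * x.
Proof. by rewrite big_const_seq count_predT iter_addr_0 mulr_natl. Qed.

Section Levels.
Variables (G : groupType) (X : topologicalType) (a : topAction G X).
Variables (J : finType).
Implicit Types (D : J -> {fset G}) (A : J -> set X).

Definition levels D A : set X := \bigcup_k set_saturate a (D k) (A k).

Lemma levelsP D A x : levels D A x <->
  exists k t w, [/\ t \in D k, A k w & x = a t w].
Proof.
split=> [[k _ [t tD [w Aw <-]]]|[k [t [w [tD Aw ->]]]]]; first by exists k, t, w.
by exists k => //; exists t => //; exists w.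
Qed.

Lemma levelsS D A A' : (forall k, A k `<=` A' k) -> levels D A `<=` levels D A'.
Proof.
move=> AA x /levelsP[k [t [w [tD Aw ->]]]]; apply/levelsP.
by exists k, t, w; split=> //; exact: AA.
Qed.

Lemma open_levels D A : (forall k, open (A k)) -> open (levels D A).
Proof.
move=> oA; apply: bigcup_open => k _; apply: bigcup_open => t _.
exact: open_act_image.
Qed.

Lemma closed_levels D A : (forall k, closed (A k)) -> closed (levels D A).
Proof.
move=> cA; apply: closed_bigcup => [|k _]; first exact: finite_finset.
by apply: closed_bigcup => [|t _]; [exact: finite_fset|exact: closed_act_image].
Qed.

Lemma closure_levels D A : closure (levels D A) `<=` levels D (closure \o A).
Proof.
have cL : closed (levels D (closure \o A)).
  by apply: closed_levels => k; exact: closed_closure.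
rewrite [X in _ `<=` X](closure_id _).1//; apply: closureS.
by apply: levelsS => k x; exact: subset_closure.
Qed.

End Levels.

Section CastleMass.
Variables (R : realType) (G : groupType) (X : topologicalType).
Variable a : topAction G X.
Variable mu : set X -> \bar R.
Hypothesis mu_inv : invariant_measures a mu.
Variables (J : finType) (S : J -> {fset G}) (W : J -> set X).
Hypothesis cSW : castle a S W.
Implicit Types (L : J -> seq G) (F : J -> G -> set X) (A B P : set X).

Let pairs L : seq (J * G) := [seq (k, t) | k <- enum J, t <- L k].

Let sum_pairs L (f : J -> G -> R) :
  \sum_k \sum_(t <- L k) f k t = \sum_(z <- pairs L) f z.1 z.2.
Proof. by rewrite big_allpairs_dep /= big_enum. Qed.

Lemma castle_sum_le L F B : (forall k t, borel_set (F k t)) -> borel_set B ->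
  (forall k, uniq (L k)) ->
  (forall k t, t \in L k ->
    [/\ t \in S k, F k t `<=` a t @` W k & F k t `<=` B]) ->
  \sum_k \sum_(t <- L k) mass mu (F k t) <= mass mu B.
Proof.
move=> bF bB uL LF; rewrite sum_pairs.
apply: (sum_mass_le mu_inv (F := fun z => F z.1 z.2)) => //.
- apply: allpairs_uniq_fibers; [exact: enum_uniq|by move=> k _; exact: uL|].
  by move=> k t k' t' _ _ _ _ [-> ->].
- by move=> _ /allpairsPdep[k [t [_ /LF[_ _ FB] ->]]].
- move=> z z' /allpairsPdep[k [t [_ /LF[tS FW _] ->]]].
  move=> /allpairsPdep[k' [t' [_ /LF[tS' FW' _] ->]]] [x /= [/FW[w Ww <-] /FW'[w' Ww' e]]].
  have [kk tt _] := levels_inj cSW tS tS' Ww Ww' (esym e).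
  by subst k' t'.
Qed.

Lemma castle_le_sum L F B : (forall k t, borel_set (F k t)) -> borel_set B ->
  (forall x, B x -> exists k t, t \in L k /\ F k t x) ->
  mass mu B <= \sum_k \sum_(t <- L k) mass mu (F k t).
Proof.
move=> bF bB BF; rewrite sum_pairs.
apply: (le_mass_sum mu_inv (F := fun z => F z.1 z.2)) => // x.
move=> /BF[k [t [tL Ft]]]; exists (k, t) => //.
by apply/allpairsPdep; exists k, t; rewrite mem_enum.
Qed.

(** Double counting. For t in the core, each point of t A is moved into [P] by some e in [E], and
    lands in the level e t A with e t still in [T]. For fixed e the map t ↦ e t is injective, so
    each level of [T] is counted at most once per e. *)
Lemma visits_mass (E T : {fset G}) P A : open P -> open A ->
  (forall x, exists2 e, e \in E & P (a e x)) ->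
  #|` core E T|%:R * mass mu A <=
    #|` E|%:R * \sum_(t <- enum_fset T) mass mu (a t @` A `&` P).
Proof.
move=> oP oA EP.
have oF t : borel_set (a t @` A `&` P).
  by apply: borel_open; apply: openI => //; exact: open_act_image.
rewrite -!sumr_const_fset.
apply: (@le_trans _ _ (\sum_(t <- enum_fset (core E T))
    \sum_(e <- enum_fset E) mass mu (a (e * t)%g @` A `&` P))).
  apply: ler_sum => t _; rewrite -(mass_act mu_inv t (borel_open oA)).
  pose Fe e := a e^-1%g @` (a (e * t)%g @` A `&` P).
  have bFe e : borel_set (Fe e).
    apply: borel_open; apply: open_act_image.
    by apply: openI => //; exact: open_act_image.
  apply: (@le_trans _ _ (\sum_(e <- enum_fset E) mass mu (Fe e))).
    apply: (le_mass_sum mu_inv) => // [|x Atx].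
      by apply: borel_open; exact: open_act_image.
    have [e eE ex] := EP x; exists e => //; rewrite /Fe act_imageE invgK.
    by split=> //; rewrite -act_imageM act_image_mem.
  by apply: ler_sum => e _; rewrite (mass_act mu_inv).
rewrite exchange_big /= [leLHS]big_seq [leRHS]big_seq; apply: ler_sum => e eE.
have -> : \sum_(t <- enum_fset (core E T)) mass mu (a (e * t)%g @` A `&` P) =
    \sum_(t <- [seq (e * t)%g | t <- enum_fset (core E T)]) mass mu (a t @` A `&` P).
  by rewrite big_map.
apply: ler_sum_subset => [t||_ /mapP[t /coreP[_ tE] ->]].
- exact: (mass_ge0 mu_inv).
- by rewrite map_inj_uniq ?fset_uniq//; exact: mulgI.
- exact: tE.
Qed.

End CastleMass.

(** * The square built from a castle *)

Section SquareSets.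
Variables (G : groupType) (X : topologicalType) (a : topAction G X).
Variables (J : finType) (S : J -> {fset G}) (W W1 W2 W3 : J -> set X).
Hypothesis cSW : castle a S W.
Hypotheses (oW1 : forall k, open (W1 k)) (oW2 : forall k, open (W2 k)).
Hypotheses (oW3 : forall k, open (W3 k)).
Hypotheses (W12 : forall k, closure (W1 k) `<=` W2 k).
Hypotheses (W23 : forall k, closure (W2 k) `<=` W3 k).
Hypotheses (W3W : forall k, closure (W3 k) `<=` W k).
Variables (n : nat) (E F : {fset G}).
Local Notation I2 := ('I_n.+1 * 'I_n.+1)%type.
Variables (D : J -> option I2 -> {fset G}) (m : J -> nat).
Hypotheses (E1 : 1%g \in E) (FE : {subset F <= E}).
Hypothesis Dm : forall k b, #|` D k b| = m k.
Hypothesis DS : forall k b e t, e \in E -> t \in D k b -> (e * t)%g \in S k.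
Hypothesis Ddisj : forall k b b' e e' t t', e \in E -> e' \in E ->
  t \in D k b -> t' \in D k b' -> (e * t = e' * t')%g -> b = b'.

Let W1W2 k : W1 k `<=` W2 k.
Proof. by apply: subset_trans (W12 (k := k)); exact: subset_closure. Qed.

Let W2W3 k : W2 k `<=` W3 k.
Proof. by apply: subset_trans (W23 (k := k)); exact: subset_closure. Qed.

Let W3W' k : W3 k `<=` W k.
Proof. by apply: subset_trans (W3W (k := k)); exact: subset_closure. Qed.

Let W2W k : W2 k `<=` W k.
Proof. by apply: subset_trans (@W3W' k); exact: W2W3. Qed.

Let W1W k : W1 k `<=` W k.
Proof. by apply: subset_trans (@W2W k); exact: W1W2. Qed.

Let clW2W k : closure (W2 k) `<=` W k.
Proof. by apply: subset_trans (@W3W' k); exact: W23. Qed.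

Lemma bin_sub k b : {subset D k b <= S k}.
Proof. by move=> t tD; rewrite -[t]mul1g; exact: DS tD. Qed.

Lemma bin_inj k b b' t : t \in D k b -> t \in D k b' -> b = b'.
Proof. by move=> tb tb'; apply: (Ddisj E1 E1 tb tb'). Qed.

Definition filled k : {fset G} :=
  seq_fset tt [seq t | ij <- enum {: I2}, t <- enum_fset (D k (Some ij))].

Lemma filledP k t : reflect (exists ij, t \in D k (Some ij)) (t \in filled k).
Proof.
rewrite seq_fsetE; apply: (iffP idP).
  by move=> /allpairsPdep[ij [t' [_ tD ->]]]; exists ij.
by move=> [ij tD]; apply/allpairsPdep; exists ij, t; rewrite mem_enum.
Qed.

(* In the notation of the definition of square divisibility, [cell i j] is
   $V_{i,j}$, [square] is $V$, [frame] is $U$ and [boundary_part] is $B$. The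
   bin [None] is left empty to make room for condition (iii). *)
Definition cell i j := levels a (fun k => D k (Some (i, j))) W2.
Definition square := \bigcup_i \bigcup_j cell i j.
Definition frame := levels a filled W3 `&` ~` levels a filled (closure \o W1).
(** From these points every element of [E] leads back to a [W1]-level of the same bin. The lower
    mass estimates all run through them. *)
Definition bin_core b := levels a (fun k => core E (D k b)) W1.
Definition boundary_part := closure square `&`
  ~` set_core a (square `&` ~` closure frame) F.

Lemma open_cell i j : open (cell i j).
Proof. exact: open_levels. Qed.

Lemma squareE : square = levels a filled W2.
Proof.
apply/seteqP; split=> x.
  move=> [i _ [j _ /levelsP[k [t [w [tD Ww ->]]]]]]; apply/levelsP.
  by exists k, t, w; split=> //; apply/filledP; exists (i, j).
move=> /levelsP[k [t [w [/filledP[[i j] tD] Ww ->]]]].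
by exists i => //; exists j => //; apply/levelsP; exists k, t, w.
Qed.

Lemma open_square : open square.
Proof. by rewrite squareE; exact: open_levels. Qed.

Lemma closure_square : closure square `<=` levels a filled (closure \o W2).
Proof. by rewrite squareE; exact: closure_levels. Qed.

Lemma open_frame : open frame.
Proof.
apply: openI; first exact: open_levels.
by apply: closed_openC; apply: closed_levels => k; exact: closed_closure.
Qed.

(** The frame is a collar around the cells: a boundary point lies over the closure of [W2], hence
    over [W3], but not over the closure of [W1], which is inside the open square. *)
Lemma square_boundary_frame : topological_boundary square `<=` frame.
Proof.
move=> x [/closure_square/levelsP[k [t [w [tT clw ->]]]]].
rewrite ((interior_id _).1 open_square) squareE.
move=> nV; split; first by apply/levelsP; exists k, t, w; split=> //; exact: W23.
move=> /levelsP[k' [t' [w' [tT' clw' e]]]]; apply: nV; apply/levelsP.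
by exists k', t', w'; split=> //; exact: W12.
Qed.

Lemma closure_frame : closure frame `<=`
  levels a filled (closure \o W3) `&` ~` levels a filled W1.
Proof.
move=> x clx; split.
  by apply: closure_levels; move: clx; apply: closureS => y [].
have cU : closed (~` levels a filled W1).
  by apply: open_closedC; exact: open_levels.
rewrite ((closure_id _).1 cU); move: clx; apply: closureS => y [_ nU] /= yU.
by apply: nU; apply: levelsS yU => k z; exact: subset_closure.
Qed.

Lemma closure_square_frame :
  closure (square `|` frame) `<=` levels a filled (closure \o W3).
Proof.
apply: subset_trans (@closure_levels _ _ _ _ _ _); apply: closureS => x [|[]//].
by rewrite squareE; apply: levelsS => k; exact: W2W3.
Qed.

Lemma bin_core_square i j : bin_core (Some (i, j)) `<=` cell i j.
Proof.
move=> x /levelsP[k [t [w [/core_sub tD /W1W2 Ww ->]]]].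
by apply/levelsP; exists k, t, w.
Qed.

(** Moving by [F] keeps such a point over [W1] in the filled levels. These lie in the square and
    miss the closure of the frame, so the point belongs to the core that [boundary_part]
    excludes. *)
Lemma bin_core_boundary ij : bin_core (Some ij) `&` boundary_part = set0.
Proof.
apply/seteqP; split=> // x [/levelsP[k [t [w [/coreP[tD tE] Ww ->]]]]].
move=> [_]; apply => s sF; rewrite act_imageE /= invgK -act_mul.
have stT : (s * t)%g \in filled k by apply/filledP; exists ij; apply: tE; exact: FE.
have stW1 : levels a filled W1 (a (s * t)%g w) by apply/levelsP; exists k, (s * t)%g, w.
split; last by move=> /closure_frame[].
by rewrite squareE; apply: levelsS stW1.
Qed.

Lemma bin_core_disjoint b b' : bin_core b `&` bin_core b' !=set0 -> b = b'.
Proof.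
move=> [x [/levelsP[k [t [w [/core_sub tD Ww ->]]]] /levelsP[k' [t' [w' [/core_sub tD' Ww' e]]]]]].
have [kk tt _] := levels_inj cSW (bin_sub tD) (bin_sub tD') (W1W Ww) (W1W Ww') e.
by subst k' t'; exact: bin_inj tD tD'.
Qed.

Lemma cell_disjoint i j i' j' : cell i j `&` cell i' j' !=set0 ->
  (i, j) = (i', j').
Proof.
move=> [x [/levelsP[k [t [w [tD Ww ->]]]] /levelsP[k' [t' [w' [tD' Ww' e]]]]]].
have [kk tt _] := levels_inj cSW (bin_sub tD) (bin_sub tD') (W2W Ww) (W2W Ww') e.
by subst k' t'; have [] := bin_inj tD tD' => -> ->.
Qed.

(** The square and the frame live on filled levels, and the closure of [W3] is still inside [W];
    disjointness of castle levels thus keeps even their closure away from the bin [None]. *)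
Lemma bin_core_outside : bin_core None `&` closure (square `|` frame) = set0.
Proof.
apply/seteqP; split=> // x [/levelsP[k [t [w [/core_sub tD Ww ->]]]]].
move=> /closure_square_frame/levelsP[k' [t' [w' [/filledP[ij tD'] Ww' e]]]].
have [kk tt _] := levels_inj cSW (bin_sub tD) (bin_sub tD') (W1W Ww) (W3W Ww') e.
by subst k' t'; have := bin_inj tD tD'.
Qed.

Lemma closed_boundary_part : closed boundary_part.
Proof.
apply: closedI; first exact: closed_closure.
apply: open_closedC.
have -> : set_core a (square `&` ~` closure frame) F =
    ~` \bigcup_(s in [set` F]) (a s^-1%g @` ~` (square `&` ~` closure frame)).
  apply/seteqP; split=> x.
    move=> xF [s sF]; rewrite act_imageE /= => ns; apply: ns.
    by have := xF s sF; rewrite act_imageE.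
  move=> nx s sF; rewrite act_imageE /=; apply: contrapT => ns.
  by apply: nx; exists s => //; rewrite act_imageE.
apply: closed_openC; apply: closed_bigcup => [|s _]; first exact: finite_fset.
apply: closed_act_image; apply: open_closedC.
apply: openI; first exact: open_square.
by apply: closed_openC; exact: closed_closure.
Qed.

(** Since all bins of a shape have [m k] elements, the l-th element of one bin is matched with the
    l-th of any other. The pieces are the single levels of the corner cell; their translates have
    disjoint closures because the closure of [W2] stays inside [W]. *)
Lemma cells_equivalent :
  pairwise_equivalent a (ord0, ord0) (fun ij : I2 => cell ij.1 ij.2).
Proof.
pose el k (ij : I2) (l : 'I_(m k)) := nth 1%g (enum_fset (D k (Some ij))) l.
have elD k ij (l : 'I_(m k)) : el k ij l \in D k (Some ij).
  by apply: mem_nth; rewrite Dm.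
have elI k ij t : t \in D k (Some ij) -> exists l : 'I_(m k), t = el k ij l.
  move=> tD; have := tD; rewrite -index_mem Dm => lm.
  by exists (Ordinal lm); rewrite /el /= nth_index.
have el_inj k ij (l l' : 'I_(m k)) : el k ij l = el k ij l' -> l = l'.
  by move=> /eqP; rewrite nth_uniq ?fset_uniq ?Dm// => /eqP/val_inj.
pose o : I2 := (ord0, ord0).
exists {k : J & 'I_(m k)}.
exists (fun kl => a (el (tag kl) o (tagged kl)) @` W2 (tag kl)).
exists (fun kl ij => (el (tag kl) ij (tagged kl) * (el (tag kl) o (tagged kl))^-1)%g).
have cellE (ij : I2) : cell ij.1 ij.2 = \bigcup_(kl in [set: {k : J & 'I_(m k)}])
    (a (el (tag kl) ij (tagged kl)) @` W2 (tag kl)).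
  case: ij => i j; apply/seteqP; split=> x.
    move=> /levelsP[k [t [w [/elI[l ->] Ww ->]]]].
    by exists (Tagged (fun k => 'I_(m k)) l) => //; exists w.
  move=> [[k l] _ [w Ww <-]]; apply/levelsP.
  by exists k, (el k (i, j) l), w; split=> //; exact: elD.
split.
- by move=> kl; apply: borel_open; exact: open_act_image.
- exact: cellE.
- by move=> kl; rewrite mulgV.
- by move=> ij; rewrite cellE; apply: eq_bigcupr => kl _; rewrite act_imageM mulgVK.
- move=> [[k l] ij] [[k' l'] ij'] _ _ /= [x]; rewrite !act_imageM !mulgVK.
  move=> [/closure_act_image[w clw <-] /closure_act_image[w' clw' e]].
  have [kk tt _] := levels_inj cSW (bin_sub (elD k ij l)) (bin_sub (elD k' ij' l'))
    (clW2W clw) (clW2W clw') (esym e).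
  subst k'; have tD := elD k ij l; have tD' := elD k ij' l'.
  rewrite -tt in tD'; have [ijij] := bin_inj tD tD'.
  by subst ij'; rewrite (el_inj _ _ _ _ tt).
Qed.

Lemma cells_disjoint_under :
  pairwise_disjoint_under a F (fun ij : I2 => cell ij.1 ij.2).
Proof.
move=> [i j] [i' j'] _ _ [x [[e eF [y ycl <-]] [e' eF' [y' ycl' ee]]]].
move: ycl => /closure_levels/levelsP[k [t [w [tD clw ye]]]].
move: ycl' => /closure_levels/levelsP[k' [t' [w' [tD' clw' ye']]]].
move: ee; rewrite ye ye' -!act_mul => ee.
have [kk tt _] := levels_inj cSW (DS (FE eF') tD') (DS (FE eF) tD)
  (clW2W clw') (clW2W clw) ee.
by subst k'; have [-> ->] := Ddisj (FE eF) (FE eF') tD tD' (esym tt).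
Qed.

(** * Mass estimates for the square *)

Variables (R : realType) (eps : R).
Hypothesis oW : forall k, open (W k).
Hypothesis Dcore : forall k,
  (1 - eps) * #|` S k|%:R <= \sum_b #|` core E (D k b)|%:R.
Let N := #|{: option I2}|.
Let q := #|` E|.
Hypothesis epsE : eps * (16 * N%:R * q%:R) = 1.
Hypothesis nq : n = (16 * q)%N.

Let q1 : 1 <= q%:R :> R.
Proof.
by rewrite ler1n cardfs_gt0; apply/fset0Pn; exists 1%g.
Qed.

Let N2 : 2 <= N%:R :> R.
Proof. by rewrite ler_nat /N card_option card_prod !card_ord. Qed.

Let eps_gt0 : 0 < eps.
Proof.
rewrite -(pmulr_lgt0 _ (x := 16 * N%:R * q%:R)) ?epsE//.
by rewrite !mulr_gt0//; [apply: lt_le_trans N2|apply: lt_le_trans q1].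
Qed.

(** The proportion of a single bin, expressed in the unit q eps in which the later estimates are
    compared. *)
Let Nq_inv : N%:R^-1 = 16 * q%:R * eps.
Proof.
have N0 : N%:R != 0 :> R by apply: lt0r_neq0; apply: lt_le_trans N2.
by apply: (mulfI N0); rewrite divff// -[LHS]epsE; ring.
Qed.

Let eps_small : 32 * q%:R * eps <= 1.
Proof.
suff : 2 * N%:R^-1 <= 1 :> R by rewrite Nq_inv; lra.
by rewrite ler_pdivrMr ?mul1r//; apply: lt_le_trans N2.
Qed.

Let qeps : eps <= q%:R * eps.
Proof. by rewrite ler_peMl// ltW. Qed.

Let card_bins k : N%:R * (m k)%:R <= #|` S k|%:R :> R.
Proof.
rewrite -natrM ler_nat.
have -> : (N * m k = size [seq t | b <- enum {: option I2}, t <- enum_fset (D k b)])%N.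
  rewrite size_allpairs_dep sumnE big_map big_enum /=.
  by under eq_bigr => b _ do rewrite Dm; rewrite sum_nat_const.
apply: leq_size_card; last by move=> _ /allpairsPdep[b [t [_ tD ->]]]; exact: bin_sub tD.
apply: (allpairs_uniq_fibers (f := fun _ t => t)); first exact: enum_uniq.
  by move=> b _; exact: fset_uniq.
by move=> b t b' t' _ tD _ tD' e; subst t'; split=> //; exact: bin_inj tD tD'.
Qed.

(** The bins together have at most |S_k| elements and their cores at least (1 - eps)|S_k|. The
    deficits are nonnegative, so each one is bounded by their sum. *)
Let bin_deficit k b : (m k)%:R - #|` core E (D k b)|%:R <= eps * #|` S k|%:R.
Proof.
have dge0 b' : 0 <= (m k)%:R - #|` core E (D k b')|%:R :> R.
  by rewrite subr_ge0 ler_nat -(Dm k b') card_core.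
have : (m k)%:R - #|` core E (D k b)|%:R <=
    \sum_b ((m k)%:R - #|` core E (D k b)|%:R) :> R.
  by rewrite (bigD1 b)//= lerDl sumr_ge0.
rewrite sumrB sumr_const -mulr_natl -/N; have := card_bins k; have := Dcore k.
lra.
Qed.

Let bin_large k : (1 - eps) * #|` S k|%:R <= N%:R * (m k)%:R.
Proof.
apply: le_trans (Dcore k) _; rewrite mulr_natl -sumr_const.
by apply: ler_sum => b _; rewrite ler_nat -(Dm k b) card_core.
Qed.

Section SquareMass.
Variable mu : set X -> \bar R.
Hypothesis mu_inv : invariant_measures a mu.
Hypothesis W1_mass : 1 - eps <= \sum_k #|` S k|%:R * mass mu (W1 k).

Let bW k : borel_set (W k). Proof. exact: borel_open. Qed.
Let bW1 k : borel_set (W1 k). Proof. exact: borel_open. Qed.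
Let b_tW k t : borel_set (a t @` W k).
Proof. by apply: borel_open; exact: open_act_image. Qed.

Lemma shapes_mass_le1 : \sum_k #|` S k|%:R * mass mu (W k) <= 1.
Proof.
rewrite -[leRHS](mass_setT mu_inv).
under eq_bigr => k _.
  rewrite -sumr_const_fset; under eq_bigr => t _ do rewrite -(mass_act mu_inv t (bW k)).
  over.
apply: (castle_sum_le mu_inv cSW) => //.
- by apply: borel_open; exact: openT.
- by move=> k; exact: fset_uniq.
- by move=> k t tS; split.
Qed.

Lemma bin_mass_le (b : option I2) A : borel_set A ->
  A `<=` levels a (fun k => D k b) W -> mass mu A <= 16 * q%:R * eps.
Proof.
move=> bA AD; apply: (@le_trans _ _ (\sum_k \sum_(t <- enum_fset (D k b)) mass mu (a t @` W k))).
  apply: (castle_le_sum mu_inv) => // x /AD/levelsP[k [t [w [tD Ww ->]]]].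
  by exists k, t; split=> //; exists w.
rewrite -Nq_inv -[leRHS]mul1r ler_pdivlMr; last by apply: lt_le_trans N2.
apply: le_trans shapes_mass_le1; rewrite mulr_suml; apply: ler_sum => k _.
under eq_bigr => t _ do rewrite (mass_act mu_inv t (bW k)).
rewrite sumr_const_fset Dm mulrAC; apply: ler_wpM2r; first exact: (mass_ge0 mu_inv).
by rewrite mulrC; exact: card_bins.
Qed.

Lemma borel_bin_core b : borel_set (bin_core b).
Proof. by apply: borel_open; exact: open_levels. Qed.

Lemma bin_cores_mass : 1 - 2 * eps <= \sum_b mass mu (bin_core b).
Proof.
apply: (@le_trans _ _ (\sum_b \sum_k \sum_(t <- enum_fset (core E (D k b)))
    mass mu (a t @` W1 k))); last first.
  apply: ler_sum => b _; apply: (castle_sum_le mu_inv cSW) => [k t||k|k t tC].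
  - by apply: borel_open; exact: open_act_image.
  - exact: borel_bin_core.
  - exact: fset_uniq.
  - split; [exact/bin_sub/(core_sub tC)|by apply: image_subset; exact: W1W|].
    by move=> _ [w Ww <-]; apply/levelsP; exists k, t, w.
rewrite exchange_big /=.
apply: (@le_trans _ _ ((1 - eps) * (1 - eps))).
  by have : 0 <= eps * eps; [apply: mulr_ge0; exact: ltW|lra].
have e1 : 0 <= 1 - eps by move: eps_small qeps q1; lra.
apply: le_trans (ler_wpM2l e1 W1_mass) _; rewrite mulr_sumr; apply: ler_sum => k _.
under eq_bigr => b _.
  under eq_bigr => t _ do rewrite (mass_act mu_inv t (bW1 k)).
  rewrite sumr_const_fset; over.
rewrite -mulr_suml mulrA; apply: ler_wpM2r; first exact: (mass_ge0 mu_inv).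
exact: Dcore.
Qed.

(** What the square misses is accounted for by the empty bin, at most 16q eps, and by the points
    outside all bin cores, at most 2 eps, which is bounded by 2q eps. *)
Lemma square_mass : mass mu (~` square) <= 18 * q%:R * eps.
Proof.
rewrite (mass_setC mu_inv); last by apply: borel_open; exact: open_square.
have : \sum_(b | b != None) mass mu (bin_core b) <= mass mu square.
  rewrite -big_filter; apply: (sum_mass_le mu_inv) => [b||||b b' _ _].
  - exact: borel_bin_core.
  - by apply: borel_open; exact: open_square.
  - by rewrite filter_uniq// index_enum_uniq.
  - move=> [[i j]|]; rewrite mem_filter//= => _ x /bin_core_square xc.
    by exists i => //; exists j.
  - exact: bin_core_disjoint.
have := bin_cores_mass; rewrite (bigD1 None)//=.
have := @bin_mass_le None _ (borel_bin_core None).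
have NW : bin_core None `<=` levels a (fun k => D k None) W.
  move=> x /levelsP[k [t [w [/core_sub tD /W1W Ww ->]]]].
  by apply/levelsP; exists k, t, w.
by move=> /(_ NW); move: qeps; lra.
Qed.

(** This set is disjoint from every bin core, including that of the empty bin, and those cores fill
    all but 2 eps. *)
Lemma gap_mass :
  mass mu (boundary_part `|` (closure frame `&` ~` square)) <= 2 * eps.
Proof.
have bB : borel_set (boundary_part `|` (closure frame `&` ~` square)).
  apply: borel_closed; apply: closedU; first exact: closed_boundary_part.
  by apply: closedI; [exact: closed_closure|apply: open_closedC; exact: open_square].
have : \sum_b mass mu (bin_core b) <=
    mass mu (~` (boundary_part `|` (closure frame `&` ~` square))).
  rewrite -big_enum /=; apply: (sum_mass_le mu_inv) => [b||||b b' _ _].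
  - exact: borel_bin_core.
  - exact: borel_setC.
  - exact: enum_uniq.
  - move=> [[i j]|] _ x xb [xB|[xU xV]].
    + have : (set0 : set X) x by rewrite -(bin_core_boundary (i, j)).
      by [].
    + by apply: xV; exists i => //; exists j => //; exact: bin_core_square.
    + have : (set0 : set X) x.
        rewrite -bin_core_outside; split=> //; move: xB.1; apply: closureS.
        by move=> y; left.
      by [].
    + have : (set0 : set X) x.
        rewrite -bin_core_outside; split=> //; move: xU; apply: closureS.
        by move=> y; right.
      by [].
  - exact: bin_core_disjoint.
by rewrite (mass_setC mu_inv bB); have := bin_cores_mass; lra.
Qed.

Lemma bin_core_visits (P : set X) b : open P ->
  (forall x, exists2 e, e \in E & P (a e x)) ->
  8 * eps <= mass mu (bin_core b `&` P).
Proof.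
move=> oP EP.
have bF k t : borel_set (a t @` W1 k `&` P).
  by apply: borel_open; apply: openI => //; exact: open_act_image.
apply: (@le_trans _ _ (\sum_k \sum_(t <- enum_fset (core E (D k b)))
    mass mu (a t @` W1 k `&` P))); last first.
  apply: (castle_sum_le mu_inv cSW) => // [|k|k t tC].
  - by apply: borel_setI; [exact: borel_bin_core|exact: borel_open].
  - exact: fset_uniq.
  - split; [exact/bin_sub/(core_sub tC)|by move=> _ [[w /W1W Ww <-] _]; exists w|].
    by move=> _ [[w Ww <-] Pw]; split=> //; apply/levelsP; exists k, t, w.
(* Per shape, m is at least 15q eps |S| and its deficit at most eps |S|, so the core has at least
   14q eps |S| elements. Discarding visits that end outside the core costs another q eps |S|;
   dividing by q leaves 13 eps. *)
apply: (@le_trans _ _ (\sum_k 13 * eps * (#|` S k|%:R * mass mu (W1 k)))).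
  rewrite -mulr_sumr; have := W1_mass; set s := \sum_k _ => s1.
  have : 13 * eps * (1 - eps) <= 13 * eps * s by apply: ler_wpM2l => //; rewrite mulr_ge0// ltW.
  apply: le_trans; have e1 : 32 * eps <= 1 by move: eps_small qeps; lra.
  have : 32 * eps * eps <= 1 * eps by apply: ler_wpM2r => //; exact: ltW.
  by move: eps_gt0; lra.
apply: ler_sum => k _; set u := mass mu (W1 k).
have u0 : 0 <= u by exact: (mass_ge0 mu_inv).
set Sc := \sum_(t <- _) _.
have := visits_mass mu_inv (D k b) oP (oW1 k) EP; rewrite -/u -/q.
(* The visits counted by [visits_mass] may end anywhere in the bin; those outside its core are
   charged to the deficit. *)
have split_sum : \sum_(t <- enum_fset (D k b)) mass mu (a t @` W1 k `&` P) <=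
    Sc + ((m k)%:R - #|` core E (D k b)|%:R) * u.
  set bad := [fset t in D k b | t \notin core E (D k b)]%fset.
  apply: (@le_trans _ _ (\sum_(t <- enum_fset (core E (D k b)) ++ enum_fset bad)
      mass mu (a t @` W1 k `&` P))).
    apply: ler_sum_subset => [t||t tD]; [exact: (mass_ge0 mu_inv)|exact: fset_uniq|].
    rewrite mem_cat; have [tC|tC] := boolP (t \in core E (D k b)).
      by apply/orP; left.
    by apply/orP; right; apply/imfsetP; exists t => //=; apply/andP.
  rewrite big_cat /= lerD2l -(Dm k b) -card_sub_core -sumr_const_fset.
  apply: ler_sum => t _; rewrite -/bad /u -(mass_act mu_inv t (bW1 k)).
  by apply: (le_mass mu_inv); [exact: bF|apply: borel_open; exact: open_act_image|move=> x []].
set T := \sum_(t <- _) _ in split_sum *; set c := #|` core E (D k b)|%:R in split_sum *.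
move=> cu; have := bin_deficit k b; have := bin_large k; rewrite -/c.
set s := #|` S k|%:R; set mk := (m k)%:R in split_sum * => large def.
have s0 : 0 <= s by rewrite /s.
have q0 : 0 < q%:R :> R by apply: lt_le_trans q1.
have mlow : 15 * q%:R * eps * s <= mk.
  have N0 : 0 < N%:R :> R by apply: lt_le_trans N2.
  rewrite -(ler_pM2l N0); apply: le_trans large.
  have -> : N%:R * (15 * q%:R * eps * s) =
      15 / 16 * (eps * (16 * N%:R * q%:R)) * s by field.
  rewrite epsE mulr1.
  by apply: ler_wpM2r => //; move: eps_small qeps; lra.
have cu' : c * u <= q%:R * Sc + q%:R * (mk - c) * u.
  apply: le_trans cu _; rewrite -mulrA -mulrDr; apply: ler_wpM2l => //; exact: ltW.
have qdef : q%:R * (mk - c) * u <= q%:R * (eps * s) * u.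
  by apply: ler_wpM2r => //; apply: ler_wpM2l => //; exact: ltW.
have clow : (14 * q%:R * eps * s) * u <= c * u.
  apply: ler_wpM2r => //.
  have : eps * s <= q%:R * eps * s by apply: ler_wpM2r.
  by lra.
rewrite -(ler_pM2l q0); move: cu' qdef clow; lra.
Qed.

(** The n = 16q columns other than [ord0] contribute 8 eps each. *)
Lemma row_visits (P : set X) i A : open P -> borel_set A ->
  (forall x, exists2 e, e \in E & P (a e x)) ->
  (forall j, j != ord0 -> bin_core (Some (i, j)) `&` P `<=` A) ->
  128 * q%:R * eps <= mass mu A.
Proof.
move=> oP bA EP PA.
apply: (@le_trans _ _ (\sum_(j : 'I_n.+1 | j != ord0)
    mass mu (bin_core (Some (i, j)) `&` P))).
  apply: (@le_trans _ _ (\sum_(j : 'I_n.+1 | j != ord0) 8 * eps)).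
    have nR : n%:R = 16 * q%:R :> R by rewrite nq natrM.
    rewrite sumr_const cardC1 card_ord /= -[leRHS]mulr_natl nR.
    by rewrite le_eqVlt; apply/orP; left; apply/eqP; ring.
  by apply: ler_sum => j _; exact: bin_core_visits.
rewrite -big_filter.
apply: (sum_mass_le mu_inv (F := fun j => bin_core (Some (i, j)) `&` P)) => [j||||j j' _ _].
- by apply: borel_setI; [exact: borel_bin_core|exact: borel_open].
- exact: bA.
- by rewrite filter_uniq// index_enum_uniq.
- by move=> j; rewrite mem_filter => /andP[j0 _]; exact: PA.
- move=> [x [[xj _] [xj' _]]].
  by have [] : Some (i, j) = Some (i, j') by apply: bin_core_disjoint; exists x.
Qed.

End SquareMass.
Lemma square_divides (P1 P2 : set X) : open P1 -> open P2 ->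
  (forall x, exists2 e, e \in E & P1 (a e x)) ->
  (forall x, exists2 e, e \in E & P2 (a e x)) ->
  (forall mu, invariant_measures a mu ->
    1 - eps <= \sum_k #|` S k|%:R * mass mu (W1 k)) ->
  (forall A B, closed A -> open B ->
    (forall mu : set X -> \bar R, invariant_measures a mu -> mass mu A < mass mu B) ->
    subequivalent a A B) ->
  squarely_divisible_wrt a P1 P2 F.
Proof.
move=> oP1 oP2 EP1 EP2 W1_mass cmp.
have qeps0 : 0 < q%:R * eps by apply: lt_le_trans qeps.
have oB : open (~` boundary_part) by apply: closed_openC; exact: closed_boundary_part.
have cellI i j : bin_core (Some (i, j)) `<=` cell i j `&` ~` boundary_part.
  move=> x xb; split; first exact: bin_core_square.
  move=> xB; suff : (set0 : set X) x by [].
  by rewrite -(bin_core_boundary (i, j)).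
exists n, cell, frame => V V1 Rm B.
have -> : V = square by [].
have oRow i : open (\bigcup_(j in [set j | j != ord0]) cell i j).
  by apply: bigcup_open => j _; exact: open_cell.
split.
- split; [exact: open_cell|exact: cells_equivalent|exact: cells_disjoint_under].
- split; [exact: open_frame|exact: square_boundary_frame].
- move=> i; have oT : open (P1 `&` \bigcup_(j in [set j | j != ord0]) cell i j `&` ~` B).
    by apply: openI => //; exact: openI.
  apply: cmp => // [|mu mu_inv]; first exact: closed_closure.
  apply: (@le_lt_trans _ _ (16 * q%:R * eps)).
    apply: (bin_mass_le mu_inv (b := Some (i, ord0))).
      by apply: borel_closed; exact: closed_closure.
    by move=> x /closure_levels; apply: levelsS => k y; exact: clW2W.
  apply: (@lt_le_trans _ _ (128 * q%:R * eps)); first by lra.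
  apply: (row_visits mu_inv (W1_mass _ mu_inv) (i := i) oP1) => //.
    exact: borel_open.
  by move=> j j0 x [/cellI[xc xB] Px]; split=> //; split=> //; exists j.
(* As the cells are disjoint, removing the first column leaves exactly the other columns; one row of
   them already has enough mass. *)
- have -> : P2 `&` square `&` ~` (V1 `|` B) =
      P2 `&` (\bigcup_i \bigcup_(j in [set j | j != ord0]) cell i j) `&` ~` B.
    apply/seteqP; split=> x.
      move=> [[Px [i _ [j _ xij]]] nx]; split; last by move=> xB; apply: nx; right.
      split=> //; exists i => //; exists j => //=; apply/eqP => j0.
      by apply: nx; left; exists i => //; rewrite -j0.
    move=> [[Px [i _ [j /= j0 xij]]] nx]; split.
      by split=> //; exists i => //; exists j.
    move=> [[i' _ xi']|//]; move/eqP: j0; apply.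
    by have [] : (i, j) = (i', ord0) by apply: cell_disjoint; exists x.
  have oT : open (P2 `&` (\bigcup_i \bigcup_(j in [set j | j != ord0]) cell i j) `&` ~` B).
    by apply: openI => //; apply: openI => //; apply: bigcup_open.
  apply: cmp => // [|mu mu_inv]; first by apply: open_closedC; exact: open_square.
  apply: (@le_lt_trans _ _ (18 * q%:R * eps)).
    exact: (square_mass mu_inv (W1_mass _ mu_inv)).
  apply: (@lt_le_trans _ _ (128 * q%:R * eps)); first by lra.
  apply: (row_visits mu_inv (W1_mass _ mu_inv) (i := ord0) oP2) => //.
    exact: borel_open.
  by move=> j j0 x [/cellI[xc xB] Px]; split=> //; split=> //; exists ord0 => //; exists j.
- have oT : open (P2 `&` ~` closure (square `|` frame)).
    by apply: openI => //; apply: closed_openC; exact: closed_closure.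
  apply: cmp => // [|mu mu_inv].
    apply: closedU; first exact: closed_boundary_part.
    by apply: closedI; [exact: closed_closure|apply: open_closedC; exact: open_square].
  apply: (le_lt_trans (gap_mass mu_inv (W1_mass _ mu_inv))).
  apply: (@lt_le_trans _ _ (8 * eps)); first by move: eps_gt0; lra.
  apply: le_trans (bin_core_visits mu_inv (W1_mass _ mu_inv) None oP2 EP2) _.
  apply: (le_mass mu_inv); [|exact: borel_open|].
    by apply: borel_setI; [exact: borel_bin_core|exact: borel_open].
  move=> x [xN Px]; split=> // xc; suff : (set0 : set X) x by [].
  by rewrite -bin_core_outside.
Qed.

End SquareSets.

(** * Square divisibility of the first factor *)

Section FactorSquare.
Variables (R : realType) (G : groupType) (X : metricType R).
Variable a : topAction G X.
Hypotheses (cX : compact [set: X]) (minX : minimal_action a).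
Hypotheses (infG : infinite_set [set: G]).
Hypotheses (urpX : uniform_Rokhlin_property a R) (cmpX : comparison a R).
Variable x0 : X.

(* Comparing the remainder with a small open set yields the neighborhood [N];
   this takes the place of a weak-* compactness argument. *)
Lemma thick_castle (K : {fset G}) (delta eps : R) : 0 < delta -> 0 < eps ->
  exists (J : finType) (S : J -> {fset G}) (W : J -> set X) (N : set X),
    [/\ castle a S W, forall k, open (W k),
      forall k, (1 - delta) * #|` S k|%:R <= #|` core K (S k)|%:R,
      open N /\ castle_remainder a S W `<=` N &
      forall mu, invariant_measures a mu -> mass mu N <= eps].
Proof.
move=> d0 eps0; have [n ne] : exists n : nat, 1 <= n%:R * eps.
  exists (Num.bound eps^-1); rewrite -ler_pdivrMr// div1r ltW//.
  by apply: archi_boundP; rewrite invr_ge0 ltW.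
have [D [oD Dx _ mD]] :=
  small_neighborhood cX minX infG urpX cmpX x0 n (@openT X) (I : [set: X] x0).
have [|eta eta0 etaD] := mass_lower_bound cX minX x0 oD; first by exists x0.
have dd : 0 < Num.min delta eta by rewrite lt_min d0.
have [J [S [W [cSW oW SK cR mR]]]] := open_castle_exists urpX K dd.
have RD : subequivalent a (castle_remainder a S W) D.
  apply: (subequivalent_mass cmpX cR oD) => mu mu_inv.
  apply: lt_le_trans (mR _ mu_inv) _; apply: le_trans (etaD _ mu_inv).
  by rewrite ge_min lexx orbT.
have [N [oN RN mN]] := subequivalent_thickening (borel_open oD) RD.
exists J, S, W, N; split=> // [k|mu mu_inv].
  apply: le_trans (SK k); apply: ler_wpM2r => //.
  by rewrite lerD2l lerN2 ge_min lexx.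
apply: le_trans (mN _ mu_inv) _.
have mDcl : mass mu D <= mass mu (closure D).
  apply: (le_mass mu_inv); [exact: borel_open| |exact: subset_closure].
  by apply: borel_closed; exact: closed_closure.
have n0 : 0 < n%:R :> R.
  by rewrite -(pmulr_lgt0 _ eps0); apply: lt_le_trans ne.
rewrite -(ler_pM2l n0); apply: le_trans ne; apply: le_trans (mD _ mu_inv).
by apply: ler_wpM2l => //; exact: ltW.
Qed.

(** Only base points with some level point outside [N] need to be kept. They form a closed set
    [A k]: outside [N] every point lies in exactly one level, so lying in a given level is the
    closed condition of avoiding all the others. Normality then fits three open sets between [A k]
    and [W k]. *)
Lemma castle_nested_bases (J : finType) (S : J -> {fset G}) (W : J -> set X)
    (N : set X) :
  castle a S W -> (forall k, open (W k)) -> open N ->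
  castle_remainder a S W `<=` N ->
  exists W1 W2 W3 : J -> set X,
    [/\ [/\ forall k, open (W1 k), forall k, open (W2 k) & forall k, open (W3 k)],
      forall k, closure (W1 k) `<=` W2 k, forall k, closure (W2 k) `<=` W3 k,
      forall k, closure (W3 k) `<=` W k &
      ~` N `<=` levels a S W1].
Proof.
move=> cSW oW oN RN.
have nX := compact_normal (@metric_hausdorff _ _) cX.
pose A k := W k `&` \bigcup_(s in [set` S k]) (a s @^-1` ~` N).
have cA k : closed (A k).
  have -> : A k = \bigcup_(s in [set` S k]) (a s @^-1` (~` N `&`
      ~` \bigcup_(z in [set z : J * G | z.2 \in S z.1 /\ z != (k, s)]) (a z.2 @` W z.1))).
    apply/seteqP; split=> x.
      move=> [Wx [s sS nN]]; exists s => //; split=> // -[[k' s'] [/= sS' ne] [w Ww e]].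
      have [kk ss _] := levels_inj cSW sS' sS Ww Wx e.
      by move: ne; rewrite kk ss eqxx.
    move=> [s sS [nN nz]]; split; last by exists s.
    have : ~ castle_remainder a S W (a s x) by move=> /RN.
    move=> /contrapT[k' _ [s' sS' [w Ww e]]].
    have [E|ne] := eqVneq (k', s') (k, s).
      by case: E => kk ss; subst k' s'; rewrite -(act_inj e).
    by case: nz; exists (k', s') => //; exists w.
  apply: closed_bigcup => [|s _]; first exact: finite_fset.
  apply: closed_act_preimage; apply: closedI; first exact: open_closedC.
  apply: open_closedC; apply: bigcup_open => z _; exact: open_act_image.
have AW k : A k `<=` W k by move=> x [].
have /choice[W3 W3P] k := closed_open_interpolation nX (cA k) (oW k) (AW k).
have /choice[W2 W2P] k : exists V, [/\ open V, A k `<=` V & closure V `<=` W3 k].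
  by have [oV AV _] := W3P k; exact: closed_open_interpolation nX (cA k) oV AV.
have /choice[W1 W1P] k : exists V, [/\ open V, A k `<=` V & closure V `<=` W2 k].
  by have [oV AV _] := W2P k; exact: closed_open_interpolation nX (cA k) oV AV.
exists W1, W2, W3; split.
- by split=> k; [case: (W1P k)|case: (W2P k)|case: (W3P k)].
- by move=> k; case: (W1P k).
- by move=> k; case: (W2P k).
- by move=> k; case: (W3P k).
- move=> x nN; have : ~ castle_remainder a S W x by move=> /RN.
  move=> /contrapT[k _ [s sS [w Ww e]]]; apply/levelsP; exists k, s, w; split=> //.
  have [_ AW1 _] := W1P k; apply: AW1; split=> //.
  by exists s => //; rewrite /preimage /= e.
Qed.

Lemma factor_squarely_divisible (P1 P2 : set X) (F : {fset G}) :
  open P1 -> open P2 -> P1 !=set0 -> P2 !=set0 -> 1%g \in F ->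
  squarely_divisible_wrt a P1 P2 F.
Proof.
move=> oP1 oP2 P10 P20 F1.
have [E1 E1P] := minimal_visits cX minX oP1 P10.
have [E2 E2P] := minimal_visits cX minX oP2 P20.
(* [F] is needed for separation, [E1] and [E2] for the visits to [P1] and [P2]; the bins are built
   for all three at once. *)
pose E := (F `|` E1 `|` E2)%fset.
have FE : {subset F <= E} by move=> s sF; rewrite !inE sF.
have EE1 : 1%g \in E by exact: FE.
pose q := #|` E|; pose n := (16 * q)%N.
pose I2 := ('I_n.+1 * 'I_n.+1)%type.
pose N := #|{: option I2}|.
have q0 : 0 < q%:R :> R by rewrite ltr0n cardfs_gt0; apply/fset0Pn; exists 1%g.
have N0' : (0 < N)%N by rewrite /N card_option.
have N0 : 0 < N%:R :> R by rewrite ltr0n.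
pose eps : R := (16 * N%:R * q%:R)^-1.
have epsE : eps * (16 * N%:R * q%:R) = 1.
  by rewrite mulVf// !mulf_neq0// ?lt0r_neq0.
have eps0 : 0 < eps by rewrite invr_gt0 !mulr_gt0.
have eps1 : eps < 1.
  have q1 : 1 <= q%:R :> R by rewrite ler1n -(ltr0n R).
  have N1 : 1 <= N%:R :> R by rewrite ler1n.
  have : 1 <= N%:R * q%:R :> R by rewrite -[leLHS]mulr1; apply: ler_pM.
  by rewrite invf_lt1 ?mulr_gt0//; lra.
have [K [delta [d0 KP]]] :=
  equal_bins cX minX infG urpX cmpX x0 EE1 N0' eps0 eps1.
have [J [S [W [Nb [cSW oW SK [oNb RNb] mNb]]]]] := thick_castle K d0 eps0.
have [W1 [W2 [W3 [[oW1 oW2 oW3] W12 W23 W3W NbW]]]] :=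
  castle_nested_bases cSW oW oNb RNb.
have /choice[D /choice[m DP]] k := KP (S k) (let: And3 h _ _ := cSW.1 k in h) (SK k).
have Dm k b : #|` D k b| = m k by have [-> _ _ _] := DP k.
have DS k b e t : e \in E -> t \in D k b -> (e * t)%g \in S k.
  by have [_ + _ _] := DP k; apply.
have Ddisj k b b' e e' t t' : e \in E -> e' \in E -> t \in D k b ->
    t' \in D k b' -> (e * t)%g = (e' * t')%g -> b = b'.
  by have [_ _ + _] := DP k; apply.
have Dcore k : (1 - eps) * #|` S k|%:R <= \sum_b #|` core E (D k b)|%:R.
  by have [_ _ _] := DP k.
apply: (square_divides cSW oW1 oW2 oW3 W12 W23 W3W EE1 FE Dm DS Ddisj oW Dcore epsE
  erefl oP1 oP2).
- by move=> x; have [e eE Pe] := E1P x; exists e; rewrite // !inE eE orbT.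
- by move=> x; have [e eE Pe] := E2P x; exists e; rewrite // !inE eE orbT.
- move=> mu mu_inv; apply: (@le_trans _ _ (mass mu (~` Nb))).
    by rewrite (mass_setC mu_inv (borel_open oNb)) lerD2l lerN2; exact: mNb.
  apply: (@le_trans _ _ (\sum_k \sum_(t <- enum_fset (S k)) mass mu (a t @` W1 k))).
    apply: (castle_le_sum mu_inv) => [k t||x /NbW/levelsP[k [t [w [tS Ww ->]]]]].
    + by apply: borel_open; exact: open_act_image.
    + by apply: borel_setC; exact: borel_open.
    + by exists k, t; split=> //; exists w.
  apply: ler_sum => k _.
  under eq_bigr => t _ do rewrite (mass_act mu_inv t (borel_open (oW1 k))).
  by rewrite sumr_const_fset.
- by move=> A B; exact: subequivalent_mass.
Qed.

End FactorSquare.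

(** * Passage to the product *)

Section Cylinders.
Variables (X Y : topologicalType) (y0 : Y).
Implicit Types A B : set X.

Definition cylinder A : set (X * Y) := [set p | A p.1].

Lemma open_cylinder A : open A -> open (cylinder A).
Proof.
by move=> oA; apply: (open_comp (f := @fst X Y)) => // p _; exact: cvg_fst.
Qed.

Lemma closed_cylinder A : closed A -> closed (cylinder A).
Proof.
move=> cA; apply: (preimage_closed (f := @fst X Y)) => // p _; exact: cvg_fst.
Qed.

Lemma closure_cylinder A : closure (cylinder A) = cylinder (closure A).
Proof.
apply/seteqP; split=> [|[x y] /= clx].
  rewrite [X in _ `<=` X](closure_id _).1; last first.
    by apply: closed_cylinder; exact: closed_closure.
  by apply: closureS => p; exact: (@subset_closure _ A p.1).
move=> N [[/= B C] [Bx Cy] BCN]; have [z [Az Bz]] := clx B Bx.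
exists (z, y); split=> //; apply: BCN; split=> //=; exact: nbhs_singleton.
Qed.

Lemma borel_cylinder A : borel_set A -> borel_set (cylinder A).
Proof.
apply: (@smallest_sub _ (sigma_algebra setT) open [set B | borel_set (cylinder B)]).
- split=> [|B bB|F bF] /=.
  + exact: borel_set0.
  + by rewrite setTD; exact: (borel_setC bB).
  + exact: (borel_bigcup bF).
- by move=> B oB; apply: borel_open; exact: open_cylinder.
Qed.

Lemma boundary_cylinder A :
  topological_boundary (cylinder A) = cylinder (topological_boundary A).
Proof.
rewrite /topological_boundary closure_cylinder; congr (_ `\` _).
have interiorE (T : topologicalType) (B : set T) : interior B = ~` closure (~` B).
  by rewrite -interiorC setCK.
by rewrite !interiorE -[~` cylinder A]/(cylinder (~` A)) closure_cylinder.
Qed.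

Lemma trivIset_cylinder (I : Type) (F : I -> set X) :
  trivIset setT F -> trivIset setT (fun i => cylinder (F i)).
Proof. by move=> trF i j _ _ [p [pi pj]]; apply: trF => //; exists p.1. Qed.

Variables (G H : groupType) (a : topAction G X) (b : topAction H Y).
Local Notation ab := (prod_action a b).

Lemma act_cylinder s A : ab s @` cylinder A = cylinder (a s.1 @` A).
Proof. by rewrite !act_imageE; apply/seteqP; split. Qed.

Lemma saturate_cylinder (E : {fset G * H}) A :
  set_saturate ab E (cylinder A) = cylinder (set_saturate a [fset s.1 | s in E]%fset A).
Proof.
apply/seteqP; split=> p.
  move=> [s sE]; rewrite act_cylinder => As; exists s.1 => //=.
  by apply/imfsetP; exists s.
move=> [_ /imfsetP[s /= sE ->] As]; exists s => //.
by rewrite act_cylinder.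
Qed.

Lemma core_cylinder (E : {fset G * H}) A :
  set_core ab (cylinder A) E = cylinder (set_core a A [fset s.1 | s in E]%fset).
Proof.
apply/seteqP; split=> p pE.
  move=> _ /imfsetP[s /= sE ->]; have := pE s sE.
  by rewrite act_cylinder.
move=> s sE; rewrite act_cylinder; apply: (pE s.1).
by apply/imfsetP; exists s.
Qed.

Lemma subequivalent_cylinder A B :
  subequivalent a A B -> subequivalent ab (cylinder A) (cylinder B).
Proof.
move=> [n [U [s [oU AU trU UB]]]].
exists n, (fun i => cylinder (U i)), (fun i => (s i, 1%g)); split.
- by move=> i; exact: open_cylinder.
- by move=> p /AU[i _ Ui]; exists i.
- rewrite (_ : (fun i => _) = fun i => cylinder (a (s i) @` U i)).
    exact: trivIset_cylinder.
  by apply/funext => i; rewrite act_cylinder.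
- by move=> i; rewrite act_cylinder => p; exact: UB.
Qed.

Lemma pairwise_equivalent_cylinder (I : finType) (i0 : I) (V : I -> set X) :
  pairwise_equivalent a i0 V ->
  pairwise_equivalent ab i0 (fun i => cylinder (V i)).
Proof.
move=> [K [C [s [bC VC s1 VsC trC]]]].
exists K, (fun k => cylinder (C k)), (fun k i => (s k i, 1%g)); split.
- by move=> k; exact: borel_cylinder.
- by rewrite VC; apply/seteqP; split.
- by move=> k; rewrite s1.
- move=> i; rewrite VsC; under [RHS]eq_bigcupr => k _ do rewrite act_cylinder.
  by apply/seteqP; split.
- rewrite (_ : (fun km => _) =
      fun km => cylinder (closure (a (s km.1 km.2) @` C km.1))).
    exact: trivIset_cylinder.
  by apply/funext => km; rewrite act_cylinder closure_cylinder.
Qed.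

(** Boolean operations, closures, boundaries and translates all commute with forming cylinders, and
    elements of [G] are lifted with trivial second component. Only the projection of [E] to [G]
    matters. *)
Lemma squarely_divisible_cylinder (P1 P2 : set X) (E : {fset G * H}) :
  squarely_divisible_wrt a P1 P2 [fset s.1 | s in E]%fset ->
  squarely_divisible_wrt ab (cylinder P1) (cylinder P2) E.
Proof.
move=> [n [W [U [[oW eqW disjW] [oU bdU] H1 H2 H3]]]].
exists n, (fun i j => cylinder (W i j)), (cylinder U) => V V1 Rm B.
pose VX := \bigcup_i \bigcup_j W i j.
have -> : V = cylinder VX by [].
have BE : B = cylinder (closure VX `&`
    ~` set_core a (VX `&` ~` closure U) [fset s.1 | s in E]%fset).
  rewrite /B -/VX (_ : V = cylinder VX)// !closure_cylinder.
  by rewrite (core_cylinder E (VX `&` ~` closure U)).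
split.
- split; [by move=> i j; exact: open_cylinder|exact: pairwise_equivalent_cylinder|].
  rewrite /pairwise_disjoint_under; under eq_fun => ij.
    rewrite closure_cylinder saturate_cylinder; over.
  exact: trivIset_cylinder.
- by split; [exact: open_cylinder|rewrite boundary_cylinder => p; exact: bdU].
- move=> i; rewrite BE closure_cylinder.
  exact: (subequivalent_cylinder (H1 i)).
- by rewrite BE; exact: (subequivalent_cylinder H2).
- rewrite BE (closure_cylinder U) (closure_cylinder (VX `|` U)).
  exact: (subequivalent_cylinder H3).
Qed.

End Cylinders.

(** * Embedding small cylinders into open sets of the product *)

Lemma open_rectangle (X Y : topologicalType) (A : set X) (B : set Y) :
  open A -> open B -> open (A `*` B).
Proof.
move=> oA oB; apply: (openI (A := cylinder A)); first exact: open_cylinder.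
by apply: (open_comp (f := @snd X Y)) => // p _; exact: cvg_snd.
Qed.

Lemma subequivalent_finite (G : groupType) (X : topologicalType)
    (a : topAction G X) (K : finType) (U : K -> set X) (s : K -> G) (A B : set X) :
  (forall k, open (U k)) -> A `<=` \bigcup_k U k ->
  trivIset setT (fun k => a (s k) @` U k) ->
  (forall k, a (s k) @` U k `<=` B) -> subequivalent a A B.
Proof.
move=> oU AU trU UB; exists #|K|, (U \o enum_val), (s \o enum_val); split=> //=.
- by move=> x /AU[k _ Uk]; exists (enum_rank k) => //=; rewrite enum_rankK.
- by move=> i j _ _ ij; apply: enum_val_inj; exact: trU.
Qed.

Section ProductSmallness.
Variables (R : realType) (G H : groupType) (X Y : metricType R).
Variables (a : topAction G X) (b : topAction H Y).
Hypotheses (cX : compact [set: X]) (cY : compact [set: Y]).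
Hypotheses (minX : minimal_action a) (minY : minimal_action b).
Hypotheses (infG : infinite_set [set: G]).
Hypotheses (urpX : uniform_Rokhlin_property a R) (cmpX : comparison a R).
Variable x0 : X.

(** A finite [P] would make [X] finite, since finitely many translates of [P] cover it; this
    contradicts the arbitrarily many points of an orbit. *)
Lemma open_infinite_points (I : finType) (P : set X) : open P -> P !=set0 ->
  exists p : I -> X, injective p /\ forall i, P (p i).
Proof.
move=> oP P0; have infP : infinite_set P.
  move=> finP; have [E EP] := minimal_visits cX minX oP P0.
  have finX : finite_set [set: X].
    apply: (@sub_finite_set _ _ (\bigcup_(e in [set` E]) (a e^-1%g @` P))).
      move=> x _; have [e eE Pe] := EP x; exists e => //.
      by rewrite act_imageE /= invgK.
    by apply: bigcup_finite => [|e _]; [exact: finite_fset|exact: finite_image].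
  have [s s_inj] := orbit_infinite cX minX infG urpX cmpX x0
    #|` fset_set [set: X]|.+1 x0.
  have : (size [seq a (s i) x0 | i <- enum 'I_(#|` fset_set [set: X]|.+1)] <=
      #|` fset_set [set: X]|)%N.
    apply: leq_size_card; first by rewrite map_inj_uniq ?enum_uniq.
    by move=> y _; rewrite in_fset_set// inE.
  by rewrite size_map size_enum_ord ltnn.
have [B BP cardB] := infinite_set_fset #|I| infP.
have lt i : (@enum_rank I i < size (enum_fset B))%N by exact: leq_trans cardB.
exists (fun i => nth x0 (enum_fset B) (enum_rank i)); split=> [i j /eqP|i].
  by rewrite nth_uniq ?fset_uniq// => /eqP/ord_inj/enum_rank_inj.
by apply: BP; exact: mem_nth.
Qed.

(* The part of [A `*` Y] over the [i]-th translate of [Q] goes into [D i `*` Q]. *)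
Lemma subequivalent_product (I : finType) (h : I -> H) (D : I -> set X)
    (A : set X) (Q : set Y) :
  open Q -> (forall y, exists i, Q (b (h i) y)) ->
  trivIset setT D -> (forall i, subequivalent a A (D i)) ->
  subequivalent (prod_action a b) (cylinder A) (\bigcup_i D i `*` Q).
Proof.
move=> oQ hQ trD AD.
have /choice[z zP] i : exists z : {n & ('I_n -> set X) * ('I_n -> G)}%type,
    [/\ forall k, open ((tagged z).1 k), A `<=` \bigcup_k (tagged z).1 k,
      trivIset setT (fun k => a ((tagged z).2 k) @` (tagged z).1 k) &
      forall k, a ((tagged z).2 k) @` (tagged z).1 k `<=` D i].
  have [n [U [s UsP]]] := AD i.
  by exists (Tagged (fun n => ('I_n -> set X) * ('I_n -> G))%type (U, s)).
pose n i := tag (z i); pose U i : 'I_(n i) -> set X := (tagged (z i)).1.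
pose s i : 'I_(n i) -> G := (tagged (z i)).2.
have sP i : [/\ forall k, open (U i k), A `<=` \bigcup_k U i k,
    trivIset setT (fun k => a (s i k) @` U i k) &
    forall k, a (s i k) @` U i k `<=` D i] := zP i.
pose K := {i : I & 'I_(n i)}.
apply: (subequivalent_finite (K := K)
  (U := fun k => U (tag k) (tagged k) `*` (b (h (tag k)) @^-1` Q))
  (s := fun k => (s (tag k) (tagged k), h (tag k)))).
- move=> k; apply: open_rectangle; last exact: open_act_preimage.
  by have [oU _ _ _] := sP (tag k).
- move=> [x y] /= Ax; have [i Qi] := hQ y; have [_ AU _ _] := sP i.
  by have [j _ Uj] := AU x Ax; exists (Tagged (fun i => 'I_(n i)) j).
- move=> [i k] [j l] _ _ [_ [[[x y] [/= Ux _] <-] [[x' y'] [/= Ux' _] [e _]]]].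
  have Dx : D i (a (s i k) x).
    by have [_ _ _ UD] := sP i; apply: (UD k); exists x.
  have ij : i = j.
    apply: trD => //; exists (a (s i k) x); split => //; rewrite -e.
    by have [_ _ _ UD] := sP j; apply: (UD l); exists x'.
  subst j; have [_ _ trU _] := sP i; rewrite (trU k l)//.
  by exists (a (s i k) x); split; [exists x|exists x'].
- move=> [i k] _ [[x y] [/= Ux Qy] <-]; split=> //=.
  by exists i => //; have [_ _ _ UD] := sP i; apply: (UD k); exists x.
Qed.

Lemma product_squarely_divisible : squarely_divisible (prod_action a b).
Proof.
move=> O oO [[x y] Oxy].
have [[P0 Q0] /= [P0x Q0y] PQO] : nbhs (x, y) O by exact: open_nbhs_nbhs.
pose P := interior P0; pose Q := interior Q0.
have oP : open P by exact: open_interior.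
have oQ : open Q by exact: open_interior.
have Px : P x by [].
have Qy : Q y by [].
have PQ : P `*` Q `<=` O.
  by move=> p [/interior_subset p1 /interior_subset p2]; apply: PQO.
have [L LQ] := minimal_visits cY minY oQ (ex_intro _ y Qy).
pose I := 'I_(size (enum_fset L)); pose h (i : I) := nth 1%g (enum_fset L) i.
have hQ y' : exists i, Q (b (h i) y').
  have [e eL Qe] := LQ y'; have eL' := eL; rewrite -index_mem in eL'.
  by exists (Ordinal eL'); rewrite /h /= nth_index.
(* The indices [None] and [Some None] mark the places of [P1] and [P2]; each [Some (Some i)] marks a
   piece of [O0], one for every translate of [Q] in the cover of [Y]. *)
have [p [p_inj Pp]] := open_infinite_points (option (option I)) oP (ex_intro _ x Px).
have [D [oD Dp DP disjD]] := open_separation (@metric_hausdorff _ _) uniform_regular p_inj oP Pp.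
pose D0 i := D (Some (Some i)).
have /choice[f fP] i : exists eta : R, 0 < eta /\
    forall mu, invariant_measures a mu -> eta <= mass mu (D0 i).
  have [|eta eta0 etaD] := mass_lower_bound cX minX x0 (oD (Some (Some i))).
    by exists (p (Some (Some i))).
  by exists eta.
have [eta eta0 etaf] := positive_lower_bound (fun i => (fP i).1).
(* [P1] and [P2] will have closures of mass at most 1/n each, so their union, of mass at most 2/n,
   fits into every single [D0 i]. *)
have [n neta] : exists n : nat, 2 < n%:R * eta.
  exists (Num.bound (2 / eta)); rewrite -ltr_pdivrMr//.
  by apply: archi_boundP; rewrite divr_ge0// ltW.
have [P1 [oP1 P1p P1D mP1]] :=
  small_neighborhood cX minX infG urpX cmpX x0 n (oD None) (Dp None).
have [P2 [oP2 P2p P2D mP2]] :=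
  small_neighborhood cX minX infG urpX cmpX x0 n (oD (Some None)) (Dp (Some None)).
have disj j k A B : A `<=` closure (D j) -> B `<=` closure (D k) -> j != k ->
    A `&` B = set0.
  move=> Aj Bk jk; apply/seteqP; split=> // z [/Aj zj /Bk zk].
  by rewrite -(disjD _ _ jk).
have P1cl : closure P1 `<=` closure (D None) by move=> z /P1D; exact: subset_closure.
have P2cl : closure P2 `<=` closure (D (Some None)).
  by move=> z /P2D; exact: subset_closure.
pose O0 : set (X * Y) := (\bigcup_i D0 i) `*` Q.
have oO0 : open O0 by apply: open_rectangle => //; apply: bigcup_open => i _; exact: oD.
have cO0 z : closure O0 z -> exists i, closure (D0 i) z.1.
  move=> cz; suff [i _ iz] : cylinder (\bigcup_i closure (D0 i)) z by exists i.
  have cl : closed (cylinder (Y := Y) (\bigcup_i closure (D0 i))).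
    apply: closed_cylinder; apply: closed_bigcup => [|i _]; first exact: finite_finset.
    exact: closed_closure.
  rewrite ((closure_id _).1 cl); apply: closureS cz => z' [[i _ Di] _].
  by exists i => //; exact: subset_closure.
have small : subequivalent (prod_action a b)
    (closure (cylinder P1) `|` closure (cylinder P2)) O0.
  rewrite !closure_cylinder.
  apply: (@subequivalent_product I h D0 (closure P1 `|` closure P2)) => //.
    move=> i j _ _ [z [zi zj]]; apply/eqP; apply: contraT => nij.
    suff : (set0 : set X) z by [].
    rewrite -(disjD (Some (Some i)) (Some (Some j)))//.
    by split; exact: subset_closure.
  move=> i; apply: (subequivalent_mass cmpX _ (oD _)) => [|mu mu_inv].
    by apply: closedU; exact: closed_closure.
  have bcl (A : set X) : borel_set (closure A) by apply: borel_closed; exact: closed_closure.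
  apply: (le_lt_trans (le_massU mu_inv (bcl P1) (bcl P2))).
  have n0 : 0 < n%:R :> R by rewrite -(pmulr_lgt0 _ eta0); apply: lt_trans neta.
  rewrite -(ltr_pM2l n0) mulrDr; have := mP1 _ mu_inv; have := mP2 _ mu_inv.
  have : n%:R * eta <= n%:R * mass mu (D0 i).
    by rewrite ler_pM2l//; apply: le_trans ((fP i).2 _ mu_inv).
  by lra.
exists O0, (cylinder P1), (cylinder P2); split.
- by split; [exact: oO0|exact: open_cylinder|exact: open_cylinder].
- split; [|by exists (p None, y)|by exists (p (Some None), y)].
  have [i _] := hQ y.
  by exists (p (Some (Some i)), y); split=> //; exists i => //; exact: Dp.
- move=> z [[i _ Di] Qz]; apply: PQ; split=> //.
  by apply: DP; exact: subset_closure Di.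
- rewrite !closure_cylinder; split; apply/seteqP; split=> // z [].
  + move=> /cO0[i iz] z1; suff : (set0 : set X) z.1 by [].
    by rewrite -(disj _ None _ _ (@subset_refl _ (closure (D0 i))) P1cl).
  + move=> /cO0[i iz] z2; suff : (set0 : set X) z.1 by [].
    by rewrite -(disj _ (Some None) _ _ (@subset_refl _ (closure (D0 i))) P2cl).
  + move=> z1 z2; suff : (set0 : set X) z.1 by [].
    by rewrite -(disj _ _ _ _ P1cl P2cl).
- split=> // E E1; apply: squarely_divisible_cylinder.
  apply: (factor_squarely_divisible cX minX infG urpX cmpX x0) => //.
  + by exists (p None).
  + by exists (p (Some None)).
  + by apply/imfsetP; exists 1%g.
Qed.

End ProductSmallness.

Theorem theorem6p1 (R : realType) (G H : groupType) (X Y : metricType R)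
    (a : topAction G X) (b : topAction H Y) :
  countable [set: G] -> countable [set: H] -> infinite_set [set: G] ->
  compact [set: X] -> compact [set: Y] ->
  minimal_action a -> minimal_action b ->
  uniform_Rokhlin_property a R -> comparison a R ->
  squarely_divisible (prod_action a b).
Proof.
(* The nonempty [O] supplies the base point of [X]; an empty product has no such [O]. *)
move=> _ _ infG cX cY minX minY urpX cmpX O oO [[x y] Oxy].
by apply: (product_squarely_divisible cX cY minX minY infG urpX cmpX x) => //; exists (x, y).
Qed.
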